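(* Let $p\geq 2$ and let $h\in C^2(\mathbb{R}^n)$ be nonnegative, positively homogeneous of degree $p$, with $\lambda|v|^2\leq\langle D^2h(x)v,v\rangle\leq\Lambda|v|^2$ for all $x\in S^{n-1}$, $v\in\mathbb{R}^n$, for some constants $0<\lambda\le\Lambda$. If $T$ is an $h$-monotone map with $T\in L^{p-1}_{\mathrm{loc}}(\mathbb{R}^n)$, then for almost every $x_0\in\mathbb{R}^n$ $$\sup_{x\in B_R(x_0)}|Tx-Tx_0|=O\left(R^{1/(p-1)}\right)\quad\text{as }R\to0,$$ that is, $T\in T^{1/(p-1),\infty}(x_0)$ for a.e. $x_0$.
   Context: A multivalued map $T:\mathbb{R}^n\to\mathcal P(\mathbb{R}^n)$ is $h$-monotone if $h(x-\xi)+h(y-\zeta)\leq h(x-\zeta)+h(y-\xi)$ for all $x,y$ with $T(x),T(y)\neq\emptyset$ and all $\xi\in T(x)$, $\zeta\in T(y)$; such maps are single-valued a.e. and are regarded as a.e. defined functions $\mathbb{R}^n\to\mathbb{R}^n$. The supremum is an essential supremum. For real $k$, $f\in T^{k,\infty}(x_0)$ means there is a polynomial $P_{x_0}$ of degree strictly less than $k$ with $\operatorname{ess\,sup}_{B_r(x_0)}|f-P_{x_0}|=O(r^k)$ as $r\to0$. *)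

(* Defs.v *)
From HB Require Import structures.
From mathcomp Require Import all_boot all_order all_algebra.
From mathcomp Require Import all_classical all_reals all_analysis.
Set Implicit Arguments. Unset Strict Implicit. Unset Printing Implicit Defensive.
Import Order.TTheory GRing.Theory Num.Theory.
Import numFieldNormedType.Exports.
Local Open Scope classical_set_scope.
Local Open Scope ring_scope.

Definition enorm (R : realType) (n : nat) (v : 'rV[R]_n) : R :=
  Num.sqrt (\sum_(i < n) v ord0 i ^+ 2).

Definition eball (R : realType) (n : nat) (c : 'rV[R]_n) (r : R) : set 'rV[R]_n :=
  [set x | enorm (x - c) < r].

(* identification of n-tuples (carrying the product = Borel sigma-algebra) *)
(* with row vectors *)
Definition vec (R : realType) (n : nat) (t : n.-tuple R) : 'rV[R]_n :=
  \row_(i < n) tnth t i.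

(* iterated Lebesgue integral over R^n of a function on tuples; for       *)
(* nonnegative Borel functions this is the Lebesgue integral on R^n       *)
(* (Tonelli). *)
Fixpoint iint (R : realType) (n : nat) : (n.-tuple R -> \bar R) -> \bar R :=
  match n with
  | 0 => fun g => g [tuple]
  | m.+1 => fun g =>
      (\int[@lebesgue_measure R]_x iint (fun t : m.-tuple R => g (cons_tuple x t)))%E
  end.

Definition rint (R : realType) (n : nat) (g : 'rV[R]_n -> \bar R) : \bar R :=
  iint (fun t : n.-tuple R => g (vec t)).

Definition borel_set (R : realType) (n : nat) (A : set 'rV[R]_n) : Prop :=
  measurable ((@vec R n) @^-1` A).

Definition borel_fun (R : realType) (n : nat) (g : 'rV[R]_n -> R) : Prop :=
  measurable_fun [set: n.-tuple R] (fun t => g (vec t)).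

Definition lnull (R : realType) (n : nat) (A : set 'rV[R]_n) : Prop :=
  exists B : set 'rV[R]_n, [/\ borel_set B, A `<=` B &
    rint (fun x => (\1_B x)%:E) = 0%E].

Definition ae (R : realType) (n : nat) (P : 'rV[R]_n -> Prop) : Prop :=
  lnull [set x | ~ P x].

Definition h_monotone (R : realType) (n : nat) (h : 'rV[R]_n -> R)
    (T : 'rV[R]_n -> set 'rV[R]_n) : Prop :=
  forall x y xi zeta, T x xi -> T y zeta ->
    h (x - xi) + h (y - zeta) <= h (x - zeta) + h (y - xi).

Definition Lloc_map (R : realType) (n : nat) (q : R)
    (T : 'rV[R]_n -> set 'rV[R]_n) : Prop :=
  exists f : 'rV[R]_n -> 'rV[R]_n,
    [/\ forall i : 'I_n, borel_fun (fun x => f x ord0 i),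
        ae (fun x => T x = [set f x]) &
        forall (c : 'rV[R]_n) (r : R),
          (rint (fun x => (\1_(eball c r) x * enorm (f x) `^ q)%:E) < +oo)%E].

Definition evec (R : realType) (n : nat) (i : 'I_n) : 'rV[R]_n := delta_mx ord0 i.

Definition pd (R : realType) (n : nat) (i : 'I_n) (f : 'rV[R]_n -> R) :
  'rV[R]_n -> R := fun x => 'D_(@evec R n i) f x.

Definition C2 (R : realType) (n : nat) (f : 'rV[R]_n -> R) : Prop :=
  [/\ continuous f,
      forall i x, derivable f x (@evec R n i),
      forall i, continuous (pd i f),
      forall i j x, derivable (pd i f) x (@evec R n j) &
      forall i j, continuous (pd j (pd i f))].

Definition hess_form (R : realType) (n : nat) (f : 'rV[R]_n -> R)
    (x v : 'rV[R]_n) : R :=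
  \sum_(i < n) \sum_(j < n) pd j (pd i f) x * v ord0 i * v ord0 j.

(* Main.v *)
(* Since h is C^2, for [K] large the relation [x |-> K x - Dh (x - T x)] is
   monotone on every ball on which [T] is bounded, and [T] is locally bounded
   because ellipticity excludes a whole cone of increments of an h-monotone map.
   Adding the identity and inverting gives a firmly nonexpansive map, which
   extends to a firmly nonexpansive [J] on the whole space (Kirszbraun-Minty).
   If the relation is far from Lipschitz at [x0], with [z1 - z0] much longer than
   [J z1 - J z0], then [J] maps a long thin tube around the segment [z0, z1] into
   a ball [B (J z0, r)], so the preimage of that ball has volume much larger than
   [r^n]. Preimages of disjoint balls being disjoint, Vitali's covering argument
   shows that such points [x0] form a null set. Hence [Dh (x - T x)] is pointwise
   Lipschitz almost everywhere, and strong monotonicity of [Dh],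
   [|Dh b - Dh a| >= c |b - a|^(p-1)], turns this into the Hoelder estimate. *)
Require Import Defs.
From HB Require Import structures.
From mathcomp Require Import all_boot all_order all_algebra.
From mathcomp Require Import all_classical all_reals all_analysis.
From mathcomp Require Import ring lra.
Import Order.TTheory GRing.Theory Num.Theory.
Import numFieldNormedType.Exports.
Set Implicit Arguments.
Unset Strict Implicit.
Unset Printing Implicit Defensive.
Local Open Scope classical_set_scope.
Local Open Scope ring_scope.

(** * Euclidean geometry of row vectors *)

(** Firmness, and not mere nonexpansiveness, is what makes the tube long compared with its image.
    Put [a = |J z1 - J z0|] and [rho = |z1 - z0|]. Monotonicity of [J] along the segment gives
    [|J z - J z0|^2 <= a * rho] there. At the scale [r = sqrt (a * rho)] the tube of radius about
    [r] holds about [rho / r = sqrt (rho / a)] disjoint balls of radius comparable to [r], and this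
    number is unbounded when the Lipschitz bound fails. The obstacle is measurability: the relation
    lives on an arbitrary set, so preimages of balls under it need not have a volume. The extension
    [J] is total and continuous, so its preimages of balls are Borel; the exceptional set itself is
    only enclosed in open unions of balls of small volume. Truncating to a ball on which [T] is
    bounded keeps the [z] bounded, so that all tubes lie in one set of finite volume. The exponent
    reflects the Hessian, of degree [p - 2] and degenerate at the origin for [p > 2]: [Dh] separates
    points only like [|b - a|^(p-1)], and inverting this costs the power [1/(p-1)]. *)

Definition dotp (R : realType) (n : nat) (u v : 'rV[R]_n) : R :=
  \sum_(i < n) u ord0 i * v ord0 i.

Lemma dotpC (R : realType) n (u v : 'rV[R]_n) : dotp u v = dotp v u.
Proof. by apply: eq_bigr => i _; rewrite mulrC. Qed.

Lemma dotpDl (R : realType) n (u v w : 'rV[R]_n) :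
  dotp (u + v) w = dotp u w + dotp v w.
Proof.
by rewrite /dotp -big_split; apply: eq_bigr => i _; rewrite mxE mulrDl.
Qed.

Lemma dotpZl (R : realType) n a (u w : 'rV[R]_n) :
  dotp (a *: u) w = a * dotp u w.
Proof.
by rewrite /dotp mulr_sumr; apply: eq_bigr => i _; rewrite mxE mulrA.
Qed.

Lemma dotpDr (R : realType) n (u v w : 'rV[R]_n) :
  dotp w (u + v) = dotp w u + dotp w v.
Proof. by rewrite !(dotpC w) dotpDl. Qed.

Lemma dotpZr (R : realType) n a (u w : 'rV[R]_n) :
  dotp w (a *: u) = a * dotp w u.
Proof. by rewrite !(dotpC w) dotpZl. Qed.

Lemma dotpNl (R : realType) n (u w : 'rV[R]_n) : dotp (- u) w = - dotp u w.
Proof. by rewrite -scaleN1r dotpZl mulN1r. Qed.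

Lemma dotpNr (R : realType) n (u w : 'rV[R]_n) : dotp w (- u) = - dotp w u.
Proof. by rewrite dotpC dotpNl dotpC. Qed.

Definition dotpE := (dotpDl, dotpDr, dotpNl, dotpNr, dotpZl, dotpZr).

Lemma dotp_suml (R : realType) n m (F : 'I_m -> 'rV[R]_n) w :
  dotp (\sum_(i < m) F i) w = \sum_(i < m) dotp (F i) w.
Proof.
elim/big_rec2: _ => [|i x y _ <-]; last by rewrite dotpDl.
by rewrite /dotp big1 // => i _; rewrite mxE mul0r.
Qed.

Lemma dotp_sumr (R : realType) n m (F : 'I_m -> 'rV[R]_n) w :
  dotp w (\sum_(i < m) F i) = \sum_(i < m) dotp w (F i).
Proof. by rewrite dotpC dotp_suml; apply: eq_bigr => i _; rewrite dotpC. Qed.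

Lemma dotpp_ge0 (R : realType) n (u : 'rV[R]_n) : 0 <= dotp u u.
Proof. by apply: sumr_ge0 => i _; rewrite -expr2 sqr_ge0. Qed.

Lemma enorm_sqr (R : realType) n (u : 'rV[R]_n) : enorm u ^+ 2 = dotp u u.
Proof.
rewrite /enorm sqr_sqrtr; last by apply: sumr_ge0 => i _; rewrite sqr_ge0.
by apply: eq_bigr => i _; rewrite expr2.
Qed.

Lemma enorm_ge0 (R : realType) n (u : 'rV[R]_n) : 0 <= enorm u.
Proof. exact: sqrtr_ge0. Qed.

Lemma enorm0 (R : realType) n : enorm (0 : 'rV[R]_n) = 0.
Proof.
rewrite /enorm big1 ?sqrtr0 // => i _.
by rewrite mxE expr0n.
Qed.

Lemma enorm_eq0 (R : realType) n (u : 'rV[R]_n) : enorm u = 0 -> u = 0.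
Proof.
move=> u0; have : dotp u u = 0 by rewrite -enorm_sqr u0 expr0n.
move/psumr_eq0P => H; apply/rowP => i; rewrite mxE.
apply/eqP; rewrite -sqrf_eq0 expr2; apply/eqP/H => // j _.
by rewrite -expr2 sqr_ge0.
Qed.

Lemma enorm_gt0 (R : realType) n (u : 'rV[R]_n) : u != 0 -> 0 < enorm u.
Proof.
move=> u0; rewrite lt_neqAle enorm_ge0 andbT eq_sym.
by apply: contra u0 => /eqP/enorm_eq0 ->.
Qed.

Lemma enormZ (R : realType) n a (u : 'rV[R]_n) :
  enorm (a *: u) = `|a| * enorm u.
Proof.
apply/eqP; rewrite -(@eqrXn2 _ 2) ?mulr_ge0 ?enorm_ge0 //.
by rewrite exprMn !enorm_sqr dotpZl dotpZr -normrX ger0_norm ?sqr_ge0 // expr2 mulrA.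
Qed.

Lemma enormN (R : realType) n (u : 'rV[R]_n) : enorm (- u) = enorm u.
Proof. by rewrite -scaleN1r enormZ normrN1 mul1r. Qed.

Lemma enorm_distC (R : realType) n (u v : 'rV[R]_n) :
  enorm (u - v) = enorm (v - u).
Proof. by rewrite -enormN opprB. Qed.

Lemma dotp_le (R : realType) n (u v : 'rV[R]_n) :
  dotp u v <= enorm u * enorm v.
Proof.
have [->|u0] := eqVneq u 0.
  by rewrite enorm0 mul0r -(scale0r (0 : 'rV[R]_n)) dotpZl mul0r.
have [->|v0] := eqVneq v 0.
  by rewrite enorm0 mulr0 -(scale0r (0 : 'rV[R]_n)) dotpZr mul0r.
have a0 := enorm_gt0 u0; have b0 := enorm_gt0 v0.
set a := enorm u in a0 *; set b := enorm v in b0 *.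
have := dotpp_ge0 (b *: u - a *: v).
rewrite !dotpE -!enorm_sqr -/a -/b (dotpC v u) => H.
rewrite -subr_ge0 -(pmulr_rge0 _ (mulr_gt0 a0 b0)); nra.
Qed.

Lemma enormD (R : realType) n (u v : 'rV[R]_n) :
  enorm (u + v) <= enorm u + enorm v.
Proof.
rewrite -(@ler_pXn2r _ 2) ?nnegrE ?addr_ge0 ?enorm_ge0 //.
rewrite sqrrD !enorm_sqr !dotpE (dotpC v u).
have := dotp_le u v; lra.
Qed.

Lemma enormB (R : realType) n (u v : 'rV[R]_n) :
  enorm (u - v) <= enorm u + enorm v.
Proof. by rewrite -(enormN v) enormD. Qed.

Lemma coord_le_norm (R : realType) n (u : 'rV[R]_n) i : `|u ord0 i| <= `|u|.
Proof.
rewrite [leRHS]/Num.norm/= mx_normrE.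
by apply: (le_trans _ (le_bigmax _ _ (ord0, i))).
Qed.

Lemma norm_le_coord (R : realType) n (u : 'rV[R]_n) r : 0 <= r ->
  (forall i, `|u ord0 i| <= r) -> `|u| <= r.
Proof.
move=> r0 H; rewrite [leLHS]/Num.norm/= mx_normrE.
by apply/bigmax_leP; split => // -[i j] _ /=; rewrite ord1.
Qed.

Lemma norm_lt_coord (R : realType) n (u : 'rV[R]_n) r : 0 < r ->
  (forall i, `|u ord0 i| < r) -> `|u| < r.
Proof.
move=> r0 H; rewrite [ltLHS]/Num.norm/= mx_normrE.
by apply/bigmax_ltP; split => // -[i j] _ /=; rewrite ord1.
Qed.

Lemma norm_le_enorm (R : realType) n (u : 'rV[R]_n) : `|u| <= enorm u.
Proof.
apply: norm_le_coord => [|i]; first exact: enorm_ge0.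
rewrite -(@ler_pXn2r _ 2) ?nnegrE ?enorm_ge0 // enorm_sqr /dotp (bigD1 i) //=.
rewrite -normrX ger0_norm ?sqr_ge0 // expr2 lerDl.
by apply: sumr_ge0 => j _; rewrite -expr2 sqr_ge0.
Qed.

Lemma enorm_le_norm (R : realType) n (u : 'rV[R]_n) : enorm u <= n%:R * `|u|.
Proof.
rewrite -(@ler_pXn2r _ 2) ?nnegrE ?mulr_ge0 ?enorm_ge0 //.
apply: (@le_trans _ _ (n%:R * `|u| ^+ 2)).
  rewrite enorm_sqr mulr_natl.
  have -> : `|u| ^+ 2 *+ n = \sum_(i < n) `|u| ^+ 2.
    by rewrite sumr_const card_ord.
  apply: ler_sum => i _; rewrite -expr2 -real_normK ?num_real //.
  by rewrite ler_pXn2r ?nnegrE // coord_le_norm.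
rewrite exprMn ler_wpM2r ?sqr_ge0 // -natrX ler_nat.
by case: n {u} => // n; rewrite expnS expn1 leq_pmulr.
Qed.

(** * Lebesgue measure behind the iterated integral *)

Definition tbox (R : realType) n (c : 'I_n -> R) (r : R) : set (n.-tuple R) :=
  [set t | forall i, `|c i - tnth t i| < r].

Lemma measurable_tbox (R : realType) n (c : 'I_n -> R) r :
  measurable (tbox c r).
Proof.
have -> : tbox c r = \big[setI/setT]_(i < n) (@tnth n R ^~ i) @^-1` (ball (c i) r).
  apply/seteqP; split => t.
    by move=> H; rewrite -bigcap_seq => i _; exact: H.
  by rewrite -bigcap_seq => H i; apply: H; rewrite /= mem_index_enum.
apply: bigsetI_measurable => i _.
rewrite -[X in measurable X]setTI; apply: measurable_tnth => //.
by rewrite ball_itv; exact: measurable_itv.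
Qed.

(** [iint] is only an iterated functional, so it is realised on indicators as a measure: the
    push-forward under [cons_tuple] of the product of Lebesgue measure with the measure found one
    dimension lower. Sigma-finiteness is carried through the induction because the product
    construction asks it of the second factor. *)
Lemma iint_measure (R : realType) n :
  exists m : {sigma_finite_measure set (n.-tuple R) -> \bar R},
    (forall A : set (n.-tuple R), measurable A ->
      iint (fun t => (\1_A t)%:E) = m A) /\
    (forall c r, 0 <= r -> m (tbox c r) = ((2 * r) ^+ n)%:E).
Proof.
elim: n => [|n [m [mE mbox]]].
  exists (\d_([tuple] : 0.-tuple R)); split => [A mA|c r r0].
    by rewrite /= diracE indicE.
  rewrite expr0 /= diracE mem_set //.
  by case.
pose phi (z : measurableTypeR R * n.-tuple R) : n.+1.-tuple R := cons_tuple z.1 z.2.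
have mphi : measurable_fun setT phi by exact: measurable_cons.
pose P : {measure set (measurableTypeR R * n.-tuple R) -> \bar R} :=
  (@lebesgue_measure R \x m)%E.
pose mu (A : set (n.+1.-tuple R)) := P (phi @^-1` A).
have mphiA A : measurable A -> measurable (phi @^-1` A).
  by move=> mA; rewrite -[X in measurable X]setTI; exact: mphi.
have mu0 : mu set0 = 0%E by rewrite /mu preimage_set0 measure0.
have mu_ge0 A : (0 <= mu A)%E by exact: measure_ge0.
have mu_add : semi_sigma_additive mu.
  move=> F mF tF mUF; rewrite /mu preimage_bigcup.
  apply: measure_semi_sigma_additive => [i||].
  - exact: mphiA.
  - apply/trivIsetP => i j _ _ ij; rewrite -preimage_setI.
    by move/trivIsetP: tF => ->//; rewrite preimage_set0.
  - by rewrite -preimage_bigcup; exact: mphiA.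
pose mu1 : {measure set (n.+1.-tuple R) -> \bar R} := HB.pack mu
  (isMeasure.Build _ _ _ mu mu0 mu_ge0 mu_add).
have mubox c r : 0 <= r -> mu (tbox c r) = ((2 * r) ^+ n.+1)%:E.
  move=> r0; rewrite /mu.
  have -> : phi @^-1` tbox c r =
      ball (c ord0) r `*` tbox (fun i => c (lift ord0 i)) r.
    apply/seteqP; split => [[x t] H|[x t] [/= Hx Ht] i].
      split => /=; first by have := H ord0.
      by move=> i; have := H (lift ord0 i); rewrite /= tnthS.
    case: (unliftP ord0 i) => [j ->|->]; last by [].
    by rewrite /= tnthS; exact: Ht.
  transitivity (@lebesgue_measure R (ball (c ord0) r) *
                m (tbox (fun i => c (lift ord0 i)) r))%E.
    apply: product_measure1E; last exact: measurable_tbox.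
    by rewrite ball_itv; exact: measurable_itv.
  rewrite lebesgue_measure_ball // mbox // -EFinM exprS; congr (_%:E).
  by rewrite mulr_natl.
have mu_sf : sigma_finite setT mu.
  exists (fun k => tbox (fun=> 0) k%:R).
    apply/seteqP; split => // t _.
    exists (Num.truncn (\sum_(i < n.+1) `|tnth t i|)).+1 => // i.
    rewrite sub0r normrN; apply: (@le_lt_trans _ _ (\sum_(i < n.+1) `|tnth t i|)).
      by rewrite (bigD1 i) //= lerDl; apply: sumr_ge0.
    exact: truncnS_gt.
  move=> k; split; first exact: measurable_tbox.
  by rewrite mubox // ltry.
pose mu2 : {sigma_finite_measure set (n.+1.-tuple R) -> \bar R} := HB.pack mu
  (isMeasure.Build _ _ _ mu mu0 mu_ge0 mu_add)
  (Measure_isSigmaFinite.Build _ _ _ mu1 mu_sf).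
exists mu2; split; last exact: mubox.
move=> A mA.
(* The product measure integrates the measure of the sections, which is one layer of [iint]. *)
rewrite /= /mu /P /product_measure1.
apply: eq_integral => x _ /=.
have mx : measurable (xsection (phi @^-1` A) x).
  by apply: measurable_xsection; exact: mphiA.
rewrite -mE //; congr iint; apply/funext => t.
rewrite !indicE; congr ((_ : bool)%:R%:E).
by apply/idP/idP; rewrite !inE /xsection /= !inE.
Qed.

(** Total on sets, but it is tied to the integral of the indicator only on Borel sets; hence the
    [borel_set] side conditions below. *)
Definition vol (R : realType) n (A : set 'rV[R]_n) : \bar R :=
  projT1 (cid (iint_measure R n)) (@vec R n @^-1` A).

Lemma rint_vol (R : realType) n (A : set 'rV[R]_n) : borel_set A ->
  rint (fun x => (\1_A x)%:E) = vol A.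
Proof.
by move=> mA; rewrite /vol; case: cid => m [/= mE _]; rewrite -mE.
Qed.

Lemma lnull_vol (R : realType) n (A B : set 'rV[R]_n) :
  borel_set B -> A `<=` B -> vol B = 0%E -> lnull A.
Proof. by move=> mB AB B0; exists B; split => //; rewrite rint_vol. Qed.

Lemma vol_lnull (R : realType) n (A : set 'rV[R]_n) : lnull A ->
  exists B, [/\ borel_set B, A `<=` B & vol B = 0%E].
Proof. by move=> [B [mB AB B0]]; exists B; split => //; rewrite -rint_vol. Qed.

Lemma le_vol (R : realType) n (A B : set 'rV[R]_n) :
  borel_set A -> borel_set B -> A `<=` B -> (vol A <= vol B)%E.
Proof.
by move=> mA mB AB; apply: le_measure; rewrite ?inE // => t; exact: AB.
Qed.

Lemma vol_ge0 (R : realType) n (A : set 'rV[R]_n) : (0 <= vol A)%E.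
Proof. exact: measure_ge0. Qed.

Lemma vol_set0 (R : realType) n : vol (set0 : set 'rV[R]_n) = 0%E.
Proof. by rewrite /vol preimage_set0 measure0. Qed.

Lemma volU (R : realType) n (A B : set 'rV[R]_n) :
  borel_set A -> borel_set B -> A `&` B = set0 ->
  vol (A `|` B) = (vol A + vol B)%E.
Proof.
move=> mA mB AB; rewrite /vol preimage_setU measureU //.
by rewrite -preimage_setI AB preimage_set0.
Qed.

Lemma volU_le (R : realType) n (A B : set 'rV[R]_n) :
  borel_set A -> borel_set B -> (vol (A `|` B) <= vol A + vol B)%E.
Proof. by move=> mA mB; rewrite /vol preimage_setU measureU2. Qed.

Lemma vol_bigcup0 (R : realType) n (B : nat -> set 'rV[R]_n) :
  (forall k, borel_set (B k)) -> (forall k, vol (B k) = 0%E) ->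
  vol (\bigcup_k B k) = 0%E.
Proof.
move=> mB B0; apply/eqP; rewrite eq_le vol_ge0 andbT /vol preimage_bigcup.
apply: le_trans (generalized_Boole_inequality _ _ _) _ => //.
  exact: bigcupT_measurable.
by rewrite eseries0 // => k _ _; exact: B0.
Qed.

Lemma lnull_bigcup (R : realType) n (A : nat -> set 'rV[R]_n) :
  (forall k, lnull (A k)) -> lnull (\bigcup_k A k).
Proof.
move=> /(_ _)/vol_lnull nA; have {nA}/choice[B HB] := nA.
apply: (@lnull_vol _ _ _ (\bigcup_k B k)).
- rewrite /borel_set preimage_bigcup; apply: bigcupT_measurable => k.
  by have [] := HB k.
- by move=> x [k _ Akx]; exists k => //; have [_ AB _] := HB k; exact: AB.
- by apply: vol_bigcup0 => k; have [] := HB k.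
Qed.

Lemma lnullS (R : realType) n (A B : set 'rV[R]_n) :
  A `<=` B -> lnull B -> lnull A.
Proof.
move=> AB [C [mC BC C0]]; exists C; split => //.
exact: subset_trans BC.
Qed.

Lemma lnullU (R : realType) n (A B : set 'rV[R]_n) :
  lnull A -> lnull B -> lnull (A `|` B).
Proof.
move=> A0 B0.
apply: (@lnullS _ _ _ (\bigcup_k (if k == 0%N then A else B))); last first.
  by apply: lnull_bigcup => -[|k].
by move=> x [Ax|Bx]; [exists 0%N|exists 1%N].
Qed.

Lemma lnull0 (R : realType) n : lnull (set0 : set 'rV[R]_n).
Proof.
apply: (@lnull_vol _ _ _ set0) => //.
by rewrite /borel_set preimage_set0; exact: measurable0.
Qed.

Lemma preimage_vec_ball (R : realType) n (c : 'rV[R]_n) r : 0 < r ->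
  @vec R n @^-1` ball c r = tbox (c ord0) r.
Proof.
move=> r0; apply/seteqP; split => t.
  rewrite /= -ball_normE /= => H i; apply: le_lt_trans H.
  by apply: le_trans (coord_le_norm _ i); rewrite !mxE.
move=> H; rewrite /= -ball_normE /=; apply: norm_lt_coord => // i.
by rewrite !mxE; exact: H.
Qed.

Lemma borel_ball (R : realType) n (c : 'rV[R]_n) r : 0 < r ->
  borel_set (ball c r).
Proof.
by move=> r0; rewrite /borel_set preimage_vec_ball //; exact: measurable_tbox.
Qed.

Lemma vol_ball (R : realType) n (c : 'rV[R]_n) r : 0 < r ->
  vol (ball c r) = ((2 * r) ^+ n)%:E.
Proof.
move=> r0; rewrite /vol preimage_vec_ball //.
by case: cid => m [/= _ ->] //; exact: ltW.
Qed.

(** A countable family of balls: it exhibits open sets as countable unions, and lets the covering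
    argument run on finite lists of codes. *)
Definition rball (R : realType) n (q : 'rV[rat]_n * rat) : set 'rV[R]_n :=
  ball (map_mx (@ratr R) q.1) (ratr q.2).

Lemma rball_approx (R : realType) n (x : 'rV[R]_n) (d a b : R) :
  0 < d -> a < b ->
  exists q : 'rV[rat]_n * rat,
    `|map_mx (@ratr R) q.1 - x| < d /\ a < ratr q.2 < b.
Proof.
move=> d0 ab.
have /(_ _)/cid-/all_sig[c Hc] (i : 'I_n) :
    exists c, ratr c \in `]x ord0 i - d, x ord0 i + d[%R.
  by apply: rat_in_itvoo; lra.
have [s Hs] := rat_in_itvoo ab.
exists (\row_i c i, s); split; last by move: Hs; rewrite in_itv.
apply: norm_lt_coord => // i; rewrite !mxE.
by have := Hc i; rewrite in_itv /= ltr_norml => /andP[? ?]; apply/andP; split; lra.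
Qed.

Lemma borel_open (R : realType) n (A : set 'rV[R]_n) : open A -> borel_set A.
Proof.
move=> oA.
(* Rational balls that stick out of [A] are replaced by [set0], so that the union runs over the
   whole countable index type. *)
pose F (q : 'rV[rat]_n * rat) : set 'rV[R]_n :=
  if `[< 0 < ratr q.2 :> R /\ rball q `<=` A >] then rball q else set0.
have -> : A = \bigcup_q F q.
  apply/seteqP; split => [x Ax|x [q _]]; last first.
    by rewrite /F; case: asboolP => // -[_]; exact.
  have /nbhs_ballP[r /= r0 xrA] : nbhs x A by exact: open_nbhs_nbhs.
  have [||q [qx /andP[q1 q2]]] := @rball_approx _ _ x (r / 4) (r / 4) (r / 2).
  - by rewrite divr_gt0.
  - by rewrite ltr_pM2l // ltf_pV2 ?posrE // ltr_nat.
  exists q => //; rewrite /F; case: asboolP => [_|].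
    by rewrite /rball -ball_normE /=; lra.
  case; split; first by lra.
  move=> y; rewrite /rball -ball_normE /= => qy.
  apply: xrA; rewrite -ball_normE /=.
  have -> : x - y = (map_mx (@ratr R) q.1 - y) - (map_mx (@ratr R) q.1 - x).
    by rewrite opprB [RHS]addrC subrKA.
  by apply: le_lt_trans (ler_normB _ _) _; lra.
rewrite /borel_set preimage_bigcup; apply: countable_bigcupT_measurable => [|q].
  exact: countableP.
rewrite /F; case: asboolP => [[q0 _]|_].
  exact: borel_ball.
by rewrite preimage_set0; exact: measurable0.
Qed.

(** * Covering *)

Definition ballsU (R : realType) n (s : seq ('rV[R]_n * R)) : set 'rV[R]_n :=
  \bigcup_(q in [set` s]) ball q.1 q.2.

Lemma open_ballsU (R : realType) n (s : seq ('rV[R]_n * R)) : open (ballsU s).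
Proof. by apply: bigcup_open => q _; exact: ball_open. Qed.

Lemma seq_argmax (R : realType) (I : eqType) (f : I -> R) (s : seq I) :
  s != [::] -> exists2 i, i \in s & forall j, j \in s -> f j <= f i.
Proof.
elim: s => // i s IH _.
have [->|s0] := eqVneq s [::].
  by exists i; rewrite ?mem_head // => j; rewrite inE => /eqP ->.
have [k ks Hk] := IH s0.
have [ki|ik] := leP (f k) (f i).
  exists i; rewrite ?mem_head // => j; rewrite inE => /predU1P[->//|/Hk].
  by move=> jk; exact: le_trans ki.
exists k; rewrite ?inE ?ks ?orbT // => j; rewrite inE => /predU1P[->|/Hk//].
exact: ltW.
Qed.

(* Vitali's greedy selection, run directly on the measures: a ball of largest
   radius, enlarged three times, absorbs all the balls that it meets. *)
Lemma vol_ballsU_le (R : realType) n (J : 'rV[R]_n -> 'rV[R]_n)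
    (Z : set 'rV[R]_n) (C : R) (s : seq ('rV[R]_n * R)) :
  continuous J -> borel_set Z -> 0 <= C ->
  (forall q, q \in s -> 0 < q.2 /\
    (((6 * q.2) ^+ n)%:E <= C%:E * vol (J @^-1` ball q.1 q.2 `&` Z))%E) ->
  (vol (ballsU s) <= C%:E * vol (J @^-1` ballsU s `&` Z))%E.
Proof.
move=> cJ mZ C0; have [m] := ubnP (size s).
have mJZ A : open A -> borel_set (J @^-1` A `&` Z).
  move=> oA; rewrite /borel_set preimage_setI; apply: measurableI => //.
  by apply: borel_open; apply: open_comp => // x _; exact: cJ.
elim: m s => // m IH s sm Hs.
have [->|s0] := eqVneq s [::].
  rewrite /ballsU set_nil bigcup_set0 (_ : vol set0 = 0%E) ?vol_set0 //.
  by rewrite mule_ge0 ?vol_ge0 // lee_fin.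
have [q qs qmax] := seq_argmax snd s0.
pose B := ball q.1 q.2.
pose s' := [seq p <- s | `[< ball p.1 p.2 `&` B = set0 >]].
have s's p : p \in s' -> p \in s by rewrite mem_filter => /andP[].
have [q0 Hq] := Hs q qs.
have qs' : q \notin s'.
  rewrite mem_filter negb_and; apply/orP; left; apply/asboolPn.
  by rewrite setIid => /seteqP[/(_ q.1)] H _; apply: H; exact: ballxx.
have {}IH : (vol (ballsU s') <= C%:E * vol (J @^-1` ballsU s' `&` Z))%E.
  apply: IH => [|p /s's/Hs//].
  rewrite ltnS in sm; apply: leq_trans sm.
  rewrite size_filter ltn_neqAle count_size andbT -all_count.
  apply/allPn; exists q => //; move: qs'.
  by rewrite mem_filter qs andbT.
have oB : open B by exact: ball_open.
have s_sub : ballsU s `<=` ball q.1 (3 * q.2) `|` ballsU s'.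
  move=> y [p /= ps py].
  have [pB|pB] := pselect (ball p.1 p.2 `&` B = set0).
    by right; exists p => //=; rewrite mem_filter ps andbT; apply/asboolP.
  left; move/eqP/set0P : pB => [w [pw qw]].
  have pq := qmax p ps.
  move: py pw qw; rewrite /B -!ball_normE /= => py pw qw.
  have -> : q.1 - y = (q.1 - w) + ((p.1 - y) - (p.1 - w)).
    by rewrite opprB (addrC (p.1 - y)) !subrKA.
  apply: le_lt_trans (ler_normD _ _) _.
  have := ler_normB (p.1 - y) (p.1 - w); lra.
have s_sup : (J @^-1` B `&` Z) `|` (J @^-1` ballsU s' `&` Z) `<=`
    J @^-1` ballsU s `&` Z.
  move=> y [[By Zy]|[[p ps' py] Zy]]; split => //; first by exists q.
  by exists p => //; exact: s's.
have disj : (J @^-1` B `&` Z) `&` (J @^-1` ballsU s' `&` Z) = set0.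
  apply/seteqP; split => // y [[By _] [[p /= + py] _]].
  rewrite mem_filter => /andP[/asboolP pB _].
  by have : (ball p.1 p.2 `&` B) (J y) by []; rewrite pB.
apply: le_trans (le_vol _ _ s_sub) _.
- by apply: borel_open; exact: open_ballsU.
- apply: borel_open; apply: openU; last exact: open_ballsU.
  by apply: ball_open.
have q30 : 0 < 3 * q.2 by rewrite mulr_gt0.
apply: le_trans (volU_le _ _) _.
- exact: borel_ball.
- by apply: borel_open; exact: open_ballsU.
(* A sup-norm ball of radius [3 * q.2] is a cube of side [6 * q.2]: this is the constant in the
   hypothesis on [s]. *)
rewrite vol_ball // mulrA -natrM.
apply: le_trans (leeD Hq IH) _.
rewrite -ge0_muleDr ?vol_ge0 //.
rewrite -volU //; [|exact: mJZ|by apply: mJZ; exact: open_ballsU].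
apply: lee_wpmul2l; first by rewrite lee_fin.
apply: le_vol => //; last by apply: mJZ; exact: open_ballsU.
by rewrite /borel_set preimage_setU; apply: measurableU; apply: mJZ => //; exact: open_ballsU.
Qed.

(** For each [e], the rational balls whose size is at most [e] times the volume of their preimage
    cover [A], up to a dimensional factor. The finite covering estimate bounds the volume of their
    union by [e * vol Z], because disjoint balls have disjoint preimages in [Z]. Intersecting these
    open sets over [e = 1/(k+1)] gives a Borel null set containing [A]. *)
Lemma lnull_of_expansion (R : realType) n (J : 'rV[R]_n -> 'rV[R]_n)
    (Z A : set 'rV[R]_n) :
  continuous J -> borel_set Z -> (vol Z < +oo)%E ->
  (forall e x, 0 < e -> A x -> exists2 r, 0 < r &
    ((r ^+ n)%:E <= e%:E * vol (J @^-1` ball x r `&` Z))%E) ->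
  lnull A.
Proof.
move=> cJ mZ Zoo HA.
pose good (e : R) (q : 'rV[rat]_n * rat) : Prop := 0 < ratr q.2 :> R /\
  (((6 * ratr q.2) ^+ n)%:E <= e%:E * vol (J @^-1` rball q `&` Z))%E.
pose balls e m : seq ('rV[R]_n * R) :=
  [seq (map_mx (@ratr R) q.1, ratr q.2) |
    q <- [seq q <- pmap unpickle (iota 0 m) | `[< good e q >]]].
pose U e := \bigcup_m ballsU (balls e m).
have mU e : borel_set (U e).
  by apply: borel_open; apply: bigcup_open => m _; exact: open_ballsU.
have volU e : 0 <= e -> (vol (U e) <= e%:E * vol Z)%E.
  (* Continuity from below carries the estimate from the finite lists [balls e m] to their union. *)
  move=> e0; rewrite /vol preimage_bigcup.
  have mono : {homo (fun m => @vec R n @^-1` ballsU (balls e m)) :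
      k m / (k <= m)%N >-> (k <= m)%O}.
    move=> k m km; apply/subsetPset => t [q /= qk qt]; exists q => //=.
    move: qk => /mapP[p + ->]; rewrite mem_filter => /andP[pg pk].
    apply/mapP; exists p => //; rewrite mem_filter pg /=.
    by rewrite -(subnKC km) iotaD pmap_cat mem_cat pk.
  have mB m : borel_set (ballsU (balls e m)).
    by apply: borel_open; exact: open_ballsU.
  have cv := nondecreasing_cvg_mu (mu := projT1 (cid (iint_measure R n)))
    (F := fun m => @vec R n @^-1` ballsU (balls e m)) mB
    (bigcupT_measurable _ mB) mono.
  rewrite -(cvg_lim _ cv) //; apply: lime_le; first by apply/cvg_ex; eexists; exact: cv.
  apply: nearW => m /=.
  apply: le_trans (vol_ballsU_le (J := J) (Z := Z) (C := e) cJ mZ e0 _) _.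
    by move=> q /mapP[p + ->]; rewrite mem_filter => /andP[/asboolP].
  apply: lee_wpmul2l; first by rewrite lee_fin.
  apply: le_vol => //; rewrite /borel_set preimage_setI; apply: measurableI => //.
  by apply: borel_open; apply: open_comp => [x _|]; [exact: cJ|exact: open_ballsU].
have AU e : 0 < e -> A `<=` U (24 ^+ n * e).
  move=> e0 x Ax; have [r r0 Hr] := HA e x e0 Ax.
  (* Radius above [2 * r] and centre within [r] of [x] make the rational ball contain [ball x r].
     Radius below [4 * r] bounds its enlarged size by [(6 * 4 * r) ^+ n], the origin of
     [24 ^+ n]. *)
  have [|q [qx /andP[q1 q2]]] := @rball_approx _ _ x r (2 * r) (4 * r) r0.
    by rewrite ltr_pM2r // ltr_nat.
  exists (pickle q).+1 => //; exists (map_mx (@ratr R) q.1, ratr q.2); last first.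
    by rewrite /= -ball_normE /=; lra.
  apply/mapP; exists q => //; rewrite mem_filter; apply/andP; split; last first.
    by rewrite mem_pmap; apply/mapP; exists (pickle q);
      [rewrite mem_iota /= add0n|rewrite pickleK].
  apply/asboolP; split; first by lra.
  have q6 : (6 * ratr q.2) ^+ n <= 24 ^+ n * r ^+ n :> R.
    by rewrite -exprMn; apply: lerXn2r; rewrite ?nnegrE; lra.
  apply: (@le_trans _ _ (24 ^+ n * r ^+ n)%:E); first by rewrite lee_fin.
  rewrite EFinM EFinM -muleA; apply: lee_wpmul2l; first by rewrite lee_fin exprn_ge0.
  apply: le_trans Hr _; apply: lee_wpmul2l; first by rewrite lee_fin ltW.
  have mJ B : open B -> borel_set (J @^-1` B `&` Z).
    move=> oB; rewrite /borel_set preimage_setI; apply: measurableI => //.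
    by apply: borel_open; apply: open_comp => // y _; exact: cJ.
  apply: le_vol; [apply: mJ; exact: ball_open|apply: mJ; exact: ball_open|].
  move=> y [xy Zy]; split => //; move: xy; rewrite /rball /= -!ball_normE /= => xy.
  rewrite -(subrKA x); apply: le_lt_trans (ler_normD _ _) _; lra.
have zfin : vol Z \is a fin_num by rewrite ge0_fin_numE ?vol_ge0.
pose V := \bigcap_k U (24 ^+ n * k.+1%:R^-1).
have mV : borel_set V.
  by rewrite /borel_set preimage_bigcap; apply: bigcapT_measurable => k; exact: mU.
apply: (@lnull_vol _ _ _ V) => //.
  by move=> x Ax k _; apply: AU.
apply/eqP; rewrite eq_le vol_ge0 andbT.
apply/lee_addgt0Pr => e e0; rewrite add0e.
pose c := 24 ^+ n * fine (vol Z).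
have c0 : 0 <= c by rewrite mulr_ge0 ?exprn_ge0 ?fine_ge0 ?vol_ge0.
pose k := Num.truncn (c / e).
apply: (@le_trans _ _ (vol (U (24 ^+ n * k.+1%:R^-1)))).
  by apply: le_vol => // x; exact.
apply: le_trans (volU _ _) _; first by rewrite mulr_ge0 ?exprn_ge0 ?invr_ge0.
rewrite -(fineK zfin) -EFinM lee_fin mulrAC -/c ler_pdivrMr // mulrC -ler_pdivrMr //.
by apply: ltW; exact: truncnS_gt.
Qed.

(** * Firmly nonexpansive extension *)

Lemma dotpBB (R : realType) n (u v : 'rV[R]_n) :
  dotp (u - v) (u - v) = dotp u u - 2 * dotp u v + dotp v v.
Proof. by rewrite !dotpE (dotpC v u); ring. Qed.

(** The variance identity. Kirszbraun's hypothesis compares only pairwise distances, so second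
    moments are split into the squared barycentre and a sum over pairs. *)
Lemma weighted_variance (R : realType) n m (c : 'I_m -> R) (u : 'I_m -> 'rV[R]_n) :
  \sum_(i < m) c i = 1 ->
  \sum_(i < m) c i * dotp (u i) (u i) =
  dotp (\sum_(i < m) c i *: u i) (\sum_(i < m) c i *: u i) +
  2^-1 * \sum_(i < m) \sum_(j < m) c i * c j * dotp (u i - u j) (u i - u j).
Proof.
move=> c1; set ub := \sum_(i < m) c i *: u i; set S := LHS.
have inner i : \sum_(j < m) c i * c j * dotp (u i - u j) (u i - u j) =
    c i * dotp (u i) (u i) - 2 * (c i * dotp (u i) ub) + c i * S.
  transitivity (\sum_(j < m) (c j * (c i * dotp (u i) (u i)) -
      2 * c i * (c j * dotp (u i) (u j)) + c i * (c j * dotp (u j) (u j)))).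
    by apply: eq_bigr => j _; rewrite dotpBB; ring.
  rewrite big_split sumrB -mulr_suml c1 mul1r -!mulr_sumr -mulrA; congr (_ - _ * (_ * _) + _).
  by rewrite /ub dotp_sumr; apply: eq_bigr => j _; rewrite dotpZr.
under [in RHS]eq_bigr do rewrite inner.
rewrite big_split /= sumrB -/S -mulr_suml c1 -mulr_sumr.
have -> : \sum_(i < m) c i * dotp (u i) ub = dotp ub ub.
  by rewrite [in RHS]/ub dotp_suml; apply: eq_bigr => i _; rewrite dotpZl.
by field.
Qed.

Definition simplex (R : realType) m : set 'rV[R]_m :=
  [set c | (forall i, 0 <= c ord0 i) /\ \sum_(i < m) c ord0 i = 1].

Lemma continuous_sumr (R : realType) (T : topologicalType) m (F : 'I_m -> T -> R) :
  (forall i, continuous (F i)) -> continuous (fun x => \sum_(i < m) F i x).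
Proof.
move=> cF; elim: m F cF => [|m IH] F cF x.
  under eq_fun do rewrite big_ord0; exact: cvg_cst.
under eq_fun do rewrite big_ord_recr; apply: cvgD; last exact: cF.
by apply: IH => i; exact: cF.
Qed.

Lemma continuous_mulr (R : realType) (T : topologicalType) (F G : T -> R) :
  continuous F -> continuous G -> continuous (fun x => F x * G x).
Proof. by move=> cF cG x; apply: cvgM; [exact: cF|exact: cG]. Qed.

Lemma continuous_subr (R : realType) (T : topologicalType) (F G : T -> R) :
  continuous F -> continuous G -> continuous (fun x => F x - G x).
Proof. by move=> cF cG x; apply: cvgB; [exact: cF|exact: cG]. Qed.

Lemma compact_simplex (R : realType) m : compact (@simplex R m).
Proof.
apply: (@subclosed_compact _ _
    [set v : 'rV[R]_m | forall i, v ord0 i \in `[0, 1]]); last first.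
- move=> c [c0 c1] i; rewrite in_itv /= c0 /= -c1 (bigD1 i) //= lerDl.
  exact: sumr_ge0.
- apply: (@rV_compact _ _ (fun=> `[(0 : R), 1]%classic)) => _.
  exact: segment_compact.
- have -> : @simplex R m = \bigcap_i [set c : 'rV[R]_m | 0 <= c ord0 i] `&`
      [set c : 'rV[R]_m | \sum_(i < m) c ord0 i = 1].
    apply/seteqP; split => c [c0 c1]; split => // i; first by move=> _; exact: c0.
    exact: (c0 i I).
  apply: closedI.
    apply: closed_bigI => i _.
    apply: (@closed_comp _ _ (fun c : 'rV[R]_m => c ord0 i) [set x | 0 <= x]).
      by move=> c _; exact: coord_continuous.
    exact: closed_ge.
  apply: (@closed_comp _ _ (fun c : 'rV[R]_m => \sum_(i < m) c ord0 i) [set x | x = 1]).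
    by move=> c _; apply: continuous_sumr => i; exact: coord_continuous.
  exact: closed_eq.
Qed.

(** First-order optimality without derivatives. If [x] were positive, the test value
    [t = x / (2 * (|D| + x))] would give [x <= t * D <= x / 2]. *)
Lemma linear_le_quadratic (R : realType) (x D : R) :
  (forall t, 0 < t -> t <= 1 -> t * x <= t ^+ 2 * D) -> x <= 0.
Proof.
move=> H; rewrite leNgt; apply/negP => x0.
have D0 : 0 < `|D| + x by rewrite ltr_pwDr.
have := H (x / (2 * (`|D| + x))); rewrite divr_gt0 ?mulr_gt0 // => /(_ isT).
have -> : x / (2 * (`|D| + x)) <= 1.
  by rewrite ler_pdivrMr ?mulr_gt0 // mul1r; have := normr_ge0 D; lra.
move=> /(_ isT); set t := x / _; have t0 : 0 < t by rewrite divr_gt0 ?mulr_gt0.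
rewrite expr2 -mulrA ler_pM2l // => xD.
have : t * D <= t * (`|D| + x) by rewrite ler_pM2l //; have := ler_norm D; lra.
have -> : t * (`|D| + x) = x / 2 by rewrite /t; field; lra.
lra.
Qed.

(* The maximiser [c] over the simplex of the concave dual function
   [q c = sum_i c_i (|b_i|^2 - r_i^2) - |sum_i c_i b_i|^2] provides the point
   [sum_i c_i b_i]: first-order optimality in the direction of the i-th vertex
   says [|x - b_i|^2 - r_i^2 <= q c], and [q <= 0] by [weighted_variance]. *)
Lemma kirszbraun_finite (R : realType) n m (a b : 'I_m.+1 -> 'rV[R]_n) (a0 : 'rV[R]_n) :
  (forall i j, dotp (b i - b j) (b i - b j) <= dotp (a i - a j) (a i - a j)) ->
  exists x, forall i, dotp (x - b i) (x - b i) <= dotp (a0 - a i) (a0 - a i).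
Proof.
move=> ab.
pose l i := dotp (b i) (b i) - dotp (a0 - a i) (a0 - a i).
pose bar (c : 'rV[R]_m.+1) := \sum_(i < m.+1) c ord0 i *: b i.
pose q (c : 'rV[R]_m.+1) := \sum_(i < m.+1) c ord0 i * l i - dotp (bar c) (bar c).
have cq : continuous q.
  have cl : continuous (fun c : 'rV[R]_m.+1 => \sum_(i < m.+1) c ord0 i * l i).
    apply: continuous_sumr => i; apply: continuous_mulr; last exact: cst_continuous.
    exact: coord_continuous.
  have cb : continuous (fun c => dotp (bar c) (bar c)).
    have -> : (fun c => dotp (bar c) (bar c)) = (fun c : 'rV[R]_m.+1 =>
        \sum_(i < m.+1) \sum_(j < m.+1) c ord0 i * (c ord0 j * dotp (b i) (b j))).
      apply/funext => x; rewrite {1}/bar dotp_suml; apply: eq_bigr => i _.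
      rewrite dotpZl dotp_sumr mulr_sumr; apply: eq_bigr => j _.
      by rewrite dotpZr.
    apply: continuous_sumr => i; apply: continuous_sumr => j.
    apply: continuous_mulr; first exact: coord_continuous.
    apply: continuous_mulr; last exact: cst_continuous.
    exact: coord_continuous.
  exact: continuous_subr cl cb.
have S0 : @simplex R m.+1 !=set0.
  exists (\row_j (j == ord0)%:R); split => [i|]; first by rewrite mxE.
  rewrite (bigD1 ord0) //= mxE eqxx big1 ?addr0 // => i /negbTE i0.
  by rewrite mxE i0.
have [c] := EVT_max_rV S0 (@compact_simplex R m.+1) (continuous_subspaceT cq).
rewrite inE => -[c0 c1] cmax.
have qc : q c <= 0.
  have l_c : \sum_(i < m.+1) c ord0 i * l i =
      \sum_(i < m.+1) c ord0 i * dotp (b i) (b i) -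
      \sum_(i < m.+1) c ord0 i * dotp (a i - a0) (a i - a0).
    rewrite -sumrB; apply: eq_bigr => i _.
    by rewrite -mulrBr /l -(opprB a0 (a i)) dotpNl dotpNr opprK.
  (* The squared barycentre of the [b i] cancels. What remains is half the difference of the two
     sums over pairs, at most zero by [ab], minus the squared barycentre of the [a i - a0]. *)
  rewrite /q l_c (weighted_variance _ c1) (weighted_variance (fun i => a i - a0) c1).
  rewrite -/(bar c); set X := dotp (bar c) (bar c).
  have := dotpp_ge0 (\sum_(i < m.+1) c ord0 i *: (a i - a0)).
  suff : \sum_(i < m.+1) \sum_(j < m.+1) c ord0 i * c ord0 j * dotp (b i - b j) (b i - b j)
    <= \sum_(i < m.+1) \sum_(j < m.+1) c ord0 i * c ord0 j *
      dotp (a i - a0 - (a j - a0)) (a i - a0 - (a j - a0)) by lra.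
  apply: ler_sum => i _; apply: ler_sum => j _.
  apply: ler_wpM2l; first by rewrite mulr_ge0.
  by rewrite opprB subrKA; exact: ab.
exists (bar c) => j.
suff : dotp (bar c - b j) (bar c - b j) - dotp (a0 - a j) (a0 - a j) - q c <= 0 by lra.
(* Moving [c] by a fraction [t] towards the [j]-th vertex moves [bar c] by [t *: (b j - bar c)], so
   the quadratic term of [q] on that segment is [- t ^+ 2] times this square. *)
apply: (@linear_le_quadratic _ _ (dotp (b j - bar c) (b j - bar c))) => t t0 t1.
pose d := (1 - t) *: c + t *: \row_i (i == j)%:R.
have dE i : d ord0 i = (1 - t) * c ord0 i + t * (i == j)%:R by rewrite !mxE.
have sum_d (F : 'I_m.+1 -> R) :
    \sum_(i < m.+1) d ord0 i * F i =
    (1 - t) * \sum_(i < m.+1) c ord0 i * F i + t * F j.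
  rewrite mulr_sumr -[t * F j](_ : \sum_(i < m.+1) t * (i == j)%:R * F i = _).
    rewrite -big_split; apply: eq_bigr => i _.
    by rewrite dE mulrDl mulrA.
  rewrite (bigD1 j) //= eqxx mulr1 big1 ?addr0 // => i /negbTE ->.
  by rewrite mulr0 mul0r.
have bar_d : bar d = bar c + t *: (b j - bar c).
  have -> : bar c + t *: (b j - bar c) = (1 - t) *: bar c + t *: b j.
    by rewrite scalerBr scalerBl scale1r addrCA addrC.
  rewrite /bar scaler_sumr -[t *: b j](_ : \sum_(i < m.+1) (t * (i == j)%:R) *: b i = _).
    rewrite -big_split; apply: eq_bigr => i _.
    by rewrite dE /=; apply/rowP => k; rewrite !mxE; ring.
  rewrite (bigD1 j) //= eqxx mulr1 big1 ?addr0 // => i /negbTE ->.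
  by rewrite mulr0 scale0r.
have Sd : d \in @simplex R m.+1.
  rewrite inE; split=> [i|].
    by rewrite dE addr_ge0 ?mulr_ge0 ?subr_ge0 // ltW.
  have := sum_d (fun=> 1); rewrite -!mulr_suml !mulr1 => ->.
  by rewrite c1; ring.
have := cmax d Sd; rewrite /q sum_d bar_d /l.
set L := \sum_(i < m.+1) c ord0 i * _; set r := dotp (a0 - a j) (a0 - a j).
rewrite !dotpE (dotpC (b j) (bar c)).
set B := dotp (bar c) (bar c); set bb := dotp (b j) (b j).
set cb := dotp (bar c) (b j) => H.
nra.
Qed.

(* A pair [(z, x)] stands for [x = J z]. *)
Definition firm (R : realType) n (G : set ('rV[R]_n * 'rV[R]_n)) : Prop :=
  forall p q, G p -> G q ->
    dotp (p.2 - q.2) (p.2 - q.2) <= dotp (p.2 - q.2) (p.1 - q.1).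

(** Completing the square: being firmly related to [(z', x')] is membership in the ball whose
    diameter joins [x'] to [x' + (z - z')]. Globally, [J] is firm exactly when [2 J - id] is
    nonexpansive, which brings the problem under Kirszbraun's theorem. *)
Lemma kirszbraun_ball (R : realType) n (x x' z z' : 'rV[R]_n) :
  let b := x' + 2^-1 *: (z - z') in
  (dotp (x - x') (x - x') <= dotp (x - x') (z - z')) =
  (dotp (x - b) (x - b) <= dotp (2^-1 *: z - 2^-1 *: z') (2^-1 *: z - 2^-1 *: z')).
Proof.
rewrite /= -scalerBr opprD addrA; move: (x - x') (z - z') => u v.
rewrite dotpBB !dotpE; apply/idP/idP; lra.
Qed.

Lemma closed_dotp_ball (R : realType) n (b : 'rV[R]_n) (r : R) :
  closed [set x | dotp (x - b) (x - b) <= r].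
Proof.
apply: (@closed_comp _ _ (fun x : 'rV[R]_n => dotp (x - b) (x - b)) [set x | x <= r]);
  last exact: closed_le.
move=> x _; apply: continuous_sumr => i.
have cb : continuous (fun x : 'rV[R]_n => (x - b) ord0 i).
  have -> : (fun x : 'rV[R]_n => (x - b) ord0 i) = (fun x => x ord0 i - b ord0 i).
    by apply/funext => y; rewrite !mxE.
  apply: continuous_subr; last exact: cst_continuous.
  exact: coord_continuous.
exact: continuous_mulr.
Qed.

Lemma compact_dotp_ball (R : realType) n (b : 'rV[R]_n) (r : R) :
  compact [set x | dotp (x - b) (x - b) <= r].
Proof.
apply: bounded_closed_compact; last exact: closed_dotp_ball.
exists (enorm b + `|r| + 1); split; first exact: num_real.
move=> M rM x /= xr; apply: le_trans (norm_le_enorm _) _.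
rewrite -(subrK b x); apply: le_trans (enormD _ _) _.
suff : enorm (x - b) <= `|r| + 1 by lra.
rewrite -(@ler_pXn2r _ 2) ?nnegrE ?enorm_ge0 ?addr_ge0 // enorm_sqr.
by have := ler_norm r; have := normr_ge0 r; nra.
Qed.

(** Each pair of [G] confines the new value to a closed ball, and Kirszbraun's finite statement
    gives the finite intersection property. Intersecting every ball with that of one fixed [p0]
    supplies the compact set, and putting [p0] in front of each finite list keeps the list
    nonempty. *)
Lemma firm_extend1 (R : realType) n (G : set ('rV[R]_n * 'rV[R]_n)) z :
  firm G -> exists x, forall p, G p ->
    dotp (x - p.2) (x - p.2) <= dotp (x - p.2) (z - p.1).
Proof.
move=> fG.
have [[p0 Gp0]|G0] := pselect (G !=set0); last first.
  by exists 0 => p Gp; exfalso; apply: G0; exists p.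
pose b (p : 'rV[R]_n * 'rV[R]_n) := p.2 + 2^-1 *: (z - p.1).
pose r (p : 'rV[R]_n * 'rV[R]_n) :=
  dotp (2^-1 *: z - 2^-1 *: p.1) (2^-1 *: z - 2^-1 *: p.1 : 'rV[R]_n).
pose K (p : 'rV[R]_n * 'rV[R]_n) := [set x | dotp (x - b p) (x - b p) <= r p].
suff [x Hx] : \bigcap_(p in G) (K p0 `&` K p) !=set0.
  by exists x => p Gp; have [_] := Hx p Gp; rewrite kirszbraun_ball.
have := @compact_dotp_ball R n (b p0) (r p0); rewrite compact_In0; apply.
  by exists K => // p _; exact: closed_dotp_ball.
move=> D' DG; pose D : seq ('rV[R]_n * 'rV[R]_n) := finmap.enum_fset D'.
pose s := p0 :: D.
pose pt (i : 'I_(size D).+1) := nth p0 s i.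
have Gpt i : G (pt i).
  rewrite /pt; have : nth p0 s i \in s by rewrite mem_nth.
  rewrite in_cons => /predU1P[->//|sD].
  by have := DG (nth p0 s i) sD; rewrite inE.
have [|x Hx] := @kirszbraun_finite R n (size D)
    (fun i => 2^-1 *: (pt i).1) (fun i => b (pt i)) (2^-1 *: z).
  (* The same completion of the square: firmness of two pairs says that their centres are no farther
     apart than their halved first components. *)
  move=> i j; have := fG _ _ (Gpt i) (Gpt j).
  rewrite /b -scalerBr.
  set x := (pt i).2; set x' := (pt j).2; set y := (pt i).1; set y' := (pt j).1.
  have -> : x + 2^-1 *: (z - y) - (x' + 2^-1 *: (z - y')) =
      (x - x') - 2^-1 *: (y - y').
    by apply/rowP => k; rewrite !mxE; ring.
  move: (x - x') (y - y') => u v.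
  rewrite dotpBB !dotpE; lra.
exists x => p /= pD.
have xK q : q \in s -> K q x.
  move=> qs; have qi : (index q s < (size D).+1)%N by rewrite -[X in (_ < X)%N]/(size s) index_mem.
  by have := Hx (Ordinal qi); rewrite /pt /= nth_index.
by split; apply: xK; rewrite in_cons ?eqxx // (_ : p \in D) ?orbT.
Qed.

(** Zorn's lemma on sets [A] of added pairs; one-point extension makes a maximal relation total.
    Asking [firm] of the union of [G] and [A], instead of asking that [A] contain [G], makes the
    empty chain harmless. Firm relations are single-valued, so the [J] obtained by choice agrees
    with [G]. *)
Lemma firm_extension (R : realType) n (G : set ('rV[R]_n * 'rV[R]_n)) :
  firm G -> exists J : 'rV[R]_n -> 'rV[R]_n,
    firm [set p | p.2 = J p.1] /\ forall p, G p -> p.2 = J p.1.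
Proof.
move=> fG.
have [F FP Ftot|A [fA maxA]] := @Zorn_bigcup _ [set A | firm (G `|` A)].
  move=> p q [Gp|[X FX Xp]] [Gq|[Y FY Yq]].
  - exact: fG.
  - by apply: (FP _ FY); [left|right].
  - by apply: (FP _ FX); [right|left].
  - have [XY|YX] := Ftot _ _ FX FY.
      by apply: (FP _ FY); right => //; exact: XY.
    by apply: (FP _ FX); right => //; exact: YX.
have tot z : exists x, (G `|` A) (z, x).
  have [x Hx] := firm_extend1 z fA.
  have [Azx|NAzx] := pselect (A (z, x)); first by exists x; right.
  exfalso; apply: (maxA (A `|` [set (z, x)])).
    split; first by move=> p; left.
    by move=> /(_ (z, x)) H; apply: NAzx; apply: H; right.
  move=> p q.
  have new p' : (G `|` A) p' -> dotp (p'.2 - x) (p'.2 - x) <= dotp (p'.2 - x) (p'.1 - z).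
    move=> /Hx; rewrite -(opprB p'.2) -(opprB p'.1) !dotpE; lra.
  have old p' : (G `|` (A `|` [set (z, x)])) p' -> (G `|` A) p' \/ p' = (z, x).
    by move=> [|[|]]; [left; left|left; right|right].
  move=> /old[Gp|->] /old[Gq|->].
  - exact: fA.
  - exact: new.
  - exact: Hx.
  - by rewrite !subrr.
have [J HJ] := choice tot.
have fJ : firm [set p | p.2 = J p.1].
  by move=> [z x] [z' x'] /= -> ->; exact: (fA _ _ (HJ z) (HJ z')).
exists J; split => // -[z x] Gp /=.
have := fA _ _ (or_introl Gp) (HJ z) => /=.
rewrite subrr => H; apply/eqP; rewrite -subr_eq0; apply/eqP/enorm_eq0.
apply/eqP; rewrite -sqrf_eq0 enorm_sqr eq_le dotpp_ge0 andbT.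
by apply: le_trans H _; rewrite /dotp big1 // => i _; rewrite [X in _ * X]mxE mulr0.
Qed.

(** * Almost everywhere Lipschitz bound *)

Lemma firm_contraction (R : realType) n (J : 'rV[R]_n -> 'rV[R]_n) z z' :
  firm [set p | p.2 = J p.1] -> enorm (J z - J z') <= enorm (z - z').
Proof.
move=> fJ; have /= H := fJ (z, J z) (z', J z') erefl erefl.
have := dotp_le (J z - J z') (z - z'); move: H; rewrite -enorm_sqr => H1 H2.
have [|lt] := leP (enorm (J z - J z')) (enorm (z - z')); first by [].
have := enorm_ge0 (z - z'); nra.
Qed.

Lemma firm_continuous (R : realType) n (J : 'rV[R]_n -> 'rV[R]_n) :
  firm [set p | p.2 = J p.1] -> continuous J.
Proof.
move=> fJ z A /nbhs_ballP[e /= e0 eA].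
(* The Euclidean norm is at most [n] times the sup norm; [n.+1] keeps the divisor positive in
   dimension zero. *)
have d0 : 0 < e / n.+1%:R by rewrite divr_gt0.
apply/nbhs_ballP; exists (e / n.+1%:R) => //= y; rewrite -ball_normE /= => zy.
apply: eA; rewrite -ball_normE /=.
apply: le_lt_trans (norm_le_enorm _) _; apply: le_lt_trans (firm_contraction _ _ fJ) _.
apply: le_lt_trans (enorm_le_norm _) _.
apply: (@le_lt_trans _ _ (n.+1%:R * `|z - y|)); first by rewrite ler_wpM2r // ler_nat.
by rewrite mulrC -ltr_pdivlMr.
Qed.

(** With [d = z1 - z0], firmness between [z] and [z0] bounds the square by [t] times the component
    of [J z - J z0] along [d]. Monotonicity between [z] and [z1] bounds that component by the one of
    [J z1 - J z0], after division by [1 - t], whence [t < 1]. *)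
Lemma firm_segment (R : realType) n (J : 'rV[R]_n -> 'rV[R]_n) z0 z1 t :
  firm [set p | p.2 = J p.1] -> 0 <= t -> t < 1 ->
  enorm (J (z0 + t *: (z1 - z0)) - J z0) ^+ 2 <=
    enorm (J z1 - J z0) * enorm (z1 - z0).
Proof.
move=> fJ t0 t1; set z := z0 + _.
have /= := fJ (z, J z) (z0, J z0) erefl erefl.
have /= := fJ (z1, J z1) (z, J z) erefl erefl.
have -> : z1 - z = (1 - t) *: (z1 - z0).
  by apply/rowP => i; rewrite !mxE; ring.
have -> : z - z0 = t *: (z1 - z0) by rewrite /z addrAC subrr add0r.
have -> : J z1 - J z = (J z1 - J z0) - (J z - J z0) by rewrite opprB subrKA.
have := dotp_le (J z1 - J z0) (z1 - z0).
move: (J z1 - J z0) (J z - J z0) (z1 - z0) => x y d.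
have := dotpp_ge0 (x - y); have := dotpp_ge0 y.
have := mulr_ge0 (enorm_ge0 x) (enorm_ge0 d).
rewrite enorm_sqr !dotpZr (_ : dotp (x - y) d = dotp x d - dotp y d); last by rewrite !dotpE.
move: (dotp (x - y) (x - y)) (enorm x * enorm d) (dotp x d) (dotp y d) (dotp y y) => A B X Y D.
move=> B0 D0 A0 XB AX DY.
have XY : 0 <= X - Y by rewrite -(@pmulr_rge0 _ (1 - t)) ?subr_gt0 //; lra.
have [Y0|/ltW Y0] := leP 0 Y.
  by have := ler_wpM2r Y0 (ltW t1); lra.
by have := mulr_ge0_le0 t0 Y0; lra.
Qed.

Lemma vol_bigU (R : realType) n (F : nat -> set 'rV[R]_n) (v : R) k :
  (forall i, borel_set (F i)) -> (forall i j, (i < j)%N -> F i `&` F j = set0) ->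
  (forall i, vol (F i) = v%:E) ->
  borel_set (\big[setU/set0]_(i < k) F i) /\
  vol (\big[setU/set0]_(i < k) F i) = (k%:R * v)%:E.
Proof.
move=> mF tF vF; elim: k => [|k [IH1 IH2]].
  rewrite big_ord0 mul0r; split; first exact: borel_open open0.
  exact: vol_set0.
rewrite big_ord_recr /=; split.
  by rewrite /borel_set preimage_setU; apply: measurableU => //; exact: mF.
rewrite volU //; last first.
  by rewrite -bigcup_mkord setI_bigcupl; apply: bigcup0 => i /= ik; exact: tF.
by rewrite [X in (X + _)%E]IH2 vF -EFinD -natr1 mulrDl mul1r.
Qed.

(** [N] disjoint cubes are strung along the segment, their centres [2 * r] apart; the factor
    [4 * N ^ 2] is what makes [2 * N * r] fit into the length. [J] sends each centre within [r] of
    [J z0] and each cube within [r] of the image of its centre. As [r] and the length are at most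
    [2 * M], every point of the cubes has norm at most [M + 2 * M + 2 * M]. *)
Lemma tube_volume (R : realType) n (J : 'rV[R]_n -> 'rV[R]_n) z0 z1 (M : R) (N : nat) :
  firm [set p | p.2 = J p.1] -> enorm z0 <= M -> enorm z1 <= M ->
  let a := enorm (J z1 - J z0) in let r := Num.sqrt (a * enorm (z1 - z0)) in
  0 < a -> (4 * N%:R ^+ 2) * a <= enorm (z1 - z0) ->
  0 < r /\ ((N%:R * (2 * (r / n.+1%:R)) ^+ n)%:E <=
    vol (J @^-1` ball (J z0) (3 * r)%R `&` ball (0%R : 'rV[R]_n) (5 * M + 1)%R))%E.
Proof.
move=> fJ z0M z1M /= ; set a := enorm (J z1 - _); set rho := enorm (z1 - z0).
set r := Num.sqrt _ => a0 Na.
have a_rho : a <= rho by exact: firm_contraction.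
have rho0 : 0 < rho by lra.
have r0 : 0 < r by rewrite sqrtr_gt0 mulr_gt0.
have r2 : r ^+ 2 = a * rho by rewrite sqr_sqrtr // ltW // mulr_gt0.
split => //.
have Nr : 2 * N%:R * r <= rho.
  rewrite -(@ler_pXn2r _ 2) ?nnegrE ?mulr_ge0 ?(ltW r0) ?(ltW rho0) //.
  have -> : (2 * N%:R * r) ^+ 2 = 4 * N%:R ^+ 2 * a * rho by rewrite exprMn r2; ring.
  by rewrite [leRHS]expr2 ler_wpM2r // ltW.
pose t (i : nat) : R := 2 * i%:R * r / rho.
pose c i := z0 + t i *: (z1 - z0).
pose s := r / n.+1%:R.
have s0 : 0 < s by rewrite divr_gt0.
have sn : n.+1%:R * s = r by rewrite mulrC divfK.
have t_ge0 i : 0 <= t i by rewrite divr_ge0 ?mulr_ge0 // ltW.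
have t_lt1 i : (i < N)%N -> t i < 1.
  move=> iN; rewrite ltr_pdivrMr // mul1r; apply: lt_le_trans Nr.
  by rewrite ltr_pM2r // ltr_pM2l // ltr_nat.
have disj i j : (i < j)%N -> ball (c i) s `&` ball (c j) s = set0.
  move=> ij; apply/seteqP; split => // y []; rewrite -!ball_normE /= => ciy cjy.
  have : n.+1%:R * `|c i - c j| < 2 * r.
    rewrite -sn mulrCA ltr_pM2l //.
    have -> : c i - c j = (c i - y) - (c j - y) by rewrite opprB addrA subrK.
    by apply: le_lt_trans (ler_normB _ _) _; rewrite mulr2n mulrDl mul1r ltrD.
  apply/negP; rewrite -leNgt.
  apply: (@le_trans _ _ (enorm (c i - c j))); last first.
    by apply: le_trans (enorm_le_norm _) _; rewrite ler_wpM2r // ler_nat.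
  have -> : c i - c j = (t i - t j) *: (z1 - z0).
    by apply/rowP => k; rewrite !mxE; ring.
  rewrite enormZ -/rho distrC ger0_norm /t -mulrBl; last first.
    by rewrite divr_ge0 ?(ltW rho0) // -mulrBl -mulrBr -natrB ?(ltnW ij) // !mulr_ge0 // ltW.
  rewrite divfK ?gt_eqF // -mulrBl ler_pM2r // -mulrBr ler_peMr //.
  by rewrite -natrB ?(ltnW ij) // ler1n subn_gt0.
have [mB vB] := @vol_bigU _ _ (fun i => ball (c i) s) ((2 * s) ^+ n) N
   (fun i => borel_ball (c i) s0) disj (fun i => vol_ball (c i) s0).
rewrite -vB; apply: le_vol => //.
  rewrite /borel_set preimage_setI; apply: measurableI.
    apply: borel_open; apply: open_comp => [y _|]; last exact: ball_open.
    exact: firm_continuous.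
  by apply: borel_open; exact: ball_open.
rewrite -(bigcup_mkord N (fun i => ball (c i) s)) => y [i /= iN]; rewrite -ball_normE /= => ciy.
have eciy : enorm (c i - y) <= r.
  apply: le_trans (enorm_le_norm _) _; rewrite -sn.
  by apply: ler_pM => //; [rewrite ler_nat|exact: ltW].
split.
  rewrite -(subrKA (J (c i))); apply: le_lt_trans (ler_normD _ _) _.
  have : `|J (c i) - J y| <= r.
    by apply: le_trans (norm_le_enorm _) _; apply: le_trans (firm_contraction _ _ fJ) _.
  have : `|J z0 - J (c i)| <= r.
    apply: le_trans (norm_le_enorm _) _; rewrite enorm_distC.
    rewrite -(@ler_pXn2r _ 2) ?nnegrE ?enorm_ge0 ?(ltW r0) // r2.
    by apply: firm_segment => //; exact: t_lt1.
  lra.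
have rhoM : rho <= 2 * M.
  by apply: le_trans (enormB _ _) _; lra.
have r_rho : r <= rho.
  by rewrite -(@ler_pXn2r _ 2) ?nnegrE ?(ltW r0) ?(ltW rho0) // r2 [leRHS]expr2 ler_wpM2r // ltW.
rewrite sub0r normrN.
apply: le_lt_trans (norm_le_enorm _) _.
have -> : y = z0 + t i *: (z1 - z0) - (c i - y) by rewrite opprB addrC subrK.
apply: le_lt_trans (enormB _ _) _.
have := enormD z0 (t i *: (z1 - z0)); rewrite enormZ ger0_norm // -/rho.
have : t i * rho <= rho by rewrite ger_pMl // ltW // t_lt1.
lra.
Qed.

(** A pointwise Lipschitz form of Mignot's theorem on monotone maps, for the inverse relation [x] to
    [z]: where the inverse has a single value and no Lipschitz constant, [tube_volume] provides the
    expansion that [lnull_of_expansion] asks for. *)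
Lemma firm_inverse_lipschitz (R : realType) n (G : set ('rV[R]_n * 'rV[R]_n)) (M : R) :
  firm G -> (forall p, G p -> enorm p.1 <= M) ->
  lnull [set x0 | exists2 z0, G (z0, x0) & (forall z, G (z, x0) -> z = z0) /\
    forall C, exists2 p, G p & C * enorm (p.2 - x0) < enorm (p.1 - z0)].
Proof.
move=> fG GM.
have [J [fJ GJ]] := firm_extension fG.
pose Z := ball (0 : 'rV[R]_n) (5 * M + 1).
have [[p Gp]|G0] := pselect (G !=set0); last first.
  apply: lnullS (lnull0 R n) => x0 [z0 Gz0 _].
  by apply: G0; exists (z0, x0).
have M0 : 0 <= M by apply: le_trans (enorm_ge0 _) (GM _ Gp).
have Z0 : 0 < 5 * M + 1 by rewrite ltr_wpDl // mulr_ge0.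
apply: (@lnull_of_expansion _ _ J Z) => //.
- exact: firm_continuous.
- exact: borel_ball.
- by rewrite vol_ball // ltry.
move=> e x0 e0 [z0 Gz0 [uz0 bad]].
(* The ratio of [(3 * r) ^+ n] to the volume of one cube of the tube. With [N >= c / e] cubes, the
   preimage is large enough for [e]. *)
pose c : R := (3 * n.+1%:R / 2) ^+ n.
pose N := (Num.truncn (c / e)).+1.
have cN : c <= e * N%:R by rewrite mulrC -ler_pdivrMr // ltW // truncnS_gt.
have [[z1 x1] Gz1 /= lt] := bad (4 * N%:R ^+ 2).
have x1E := GJ _ Gz1; have x0E := GJ _ Gz0; rewrite /= in x1E x0E.
(* Single-valuedness over [x0] enters here: [x1 = x0] would force [z1 = z0], against the strict
   inequality [lt]. *)
have a0 : 0 < enorm (J z1 - J z0).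
  apply: enorm_gt0; rewrite -x1E -x0E subr_eq0; apply/eqP => x10.
  move: Gz1 lt; rewrite x10 => /uz0 ->; rewrite !subrr !enorm0 mulr0.
  by rewrite ltxx.
have [|r0 Hr] := @tube_volume R n J z0 z1 M N fJ (GM _ Gz0) (GM _ Gz1) a0.
  by rewrite -x1E -x0E ltW.
set r := Num.sqrt _ in r0 Hr.
exists (3 * r); first by rewrite mulr_gt0.
rewrite x0E; apply: (@le_trans _ _ (e * (N%:R * (2 * (r / n.+1%:R)) ^+ n))%:E); last first.
  by rewrite EFinM; apply: lee_wpmul2l => //; rewrite lee_fin ltW.
rewrite lee_fin [leRHS]mulrA.
apply: (@le_trans _ _ (c * (2 * (r / n.+1%:R)) ^+ n)); last first.
  by rewrite ler_wpM2r // exprn_ge0 // mulr_ge0 // divr_ge0 // ltW.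
rewrite /c -exprMn; apply: lerXn2r.
- by rewrite nnegrE mulr_ge0 // ltW.
- by rewrite nnegrE !mulr_ge0 ?invr_ge0 // ltW.
rewrite le_eqVlt; apply/orP; left; apply/eqP; field.
by rewrite gt_eqF ?ltr_wpDr ?ltr_wpDl ?ltr0Sn.
Qed.

(** * Calculus on row vectors *)

Lemma is_derive_epsP (R : realType) (g : R -> R) (t d : R) :
  is_derive t 1 g d <->
  forall e, 0 < e -> exists2 delta, 0 < delta &
    forall s, `|s| < delta -> `|g (t + s) - g t - s * d| <= e * `|s|.
Proof.
have quot (s : R) e : s != 0 ->
    (`|d - s^-1 *: ((g \o shift t) (s *: 1) - g t)| <= e) =
    (`|g (t + s) - g t - s * d| <= e * `|s|).
  move=> s0; rewrite -ler_pdivrMr ?normr_gt0 // -normrV ?unitfE // -normrM distrC /=.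
  congr (`|_| <= _); rewrite /GRing.scale /= mulr1 (addrC s t).
  by field.
split=> [[dg dgE] e e0|H].
  have /cvgrPdist_le/(_ e e0)/nbhs_ballP[r /= r0 Hr] :
      (fun s => s^-1 *: ((g \o shift t) (s *: 1) - g t)) @ 0^' --> d.
    by move: dg => /cvg_ex[l Hl]; rewrite -dgE /derive (cvg_lim _ Hl).
  exists r => // s sr; have [->|s0] := eqVneq s 0.
    by rewrite addr0 subrr mul0r subrr normr0 mulr0.
  by rewrite -quot //; apply: Hr => //; rewrite -ball_normE /= sub0r normrN.
have C : (fun s => s^-1 *: ((g \o shift t) (s *: 1) - g t)) @ 0^' --> d.
  apply/cvgrPdist_le => e /H[r r0 Hr]; apply/nbhs_ballP; exists r => //= s.
  by rewrite -ball_normE /= sub0r normrN => sr s0; rewrite quot //; exact: Hr.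
split; first by apply/cvg_ex; exists d.
exact: cvg_lim C.
Qed.

Lemma mean_value (R : realType) (g dg : R -> R) (a b : R) : a < b ->
  (forall x : R, is_derive x 1 g (dg x)) ->
  exists2 c, a < c < b & g b - g a = dg c * (b - a).
Proof.
move=> ab Hg.
have [|c cab E] := @MVT R g dg a b ab (fun x _ => Hg x).
  apply: derivable_within_continuous => x _; exact: ex_derive.
by exists c => //; move: cab; rewrite in_itv.
Qed.

Lemma mean_value0 (R : realType) (g dg : R -> R) (b : R) :
  (forall x : R, is_derive x 1 g (dg x)) ->
  exists2 c, `|c| <= `|b| & g b - g 0 = dg c * b.
Proof.
move=> Hg; have [b0|b0|->] := ltgtP b 0.
- have [c /andP[bc c0] E] := mean_value b0 Hg.
  exists c; first by rewrite !ltr0_norm // lerN2 ltW.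
  by rewrite -opprB E sub0r mulrN opprK.
- have [c /andP[c0 cb] E] := mean_value b0 Hg.
  exists c; first by rewrite !gtr0_norm // ltW.
  by rewrite E subr0.
- by exists 0; rewrite ?subrr ?mulr0.
Qed.

Lemma is_derive_coord (R : realType) n (f : 'rV[R]_n -> R) i y (t : R) :
  (forall x, derivable f x (@evec R n i)) ->
  is_derive t 1 (fun t => f (y + t *: @evec R n i)) (pd i f (y + t *: @evec R n i)).
Proof.
move=> df.
have E : (fun s : R => s^-1 *: (((fun t => f (y + t *: @evec R n i)) \o shift t) (s *: 1)
     - f (y + t *: @evec R n i))) =
   (fun s : R => s^-1 *: ((f \o shift (y + t *: @evec R n i)) (s *: @evec R n i)
     - f (y + t *: @evec R n i))).
  apply/funext => s; congr (_ *: (f _ - _)).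
  rewrite /= (_ : s *: (1 : R) = s); last exact: mulr1.
  by rewrite scalerDl addrCA.
by split; rewrite ?/derivable ?/derive /pd ?/derive E //; exact: df.
Qed.

Lemma continuous_eps (R : realType) n (F : 'rV[R]_n -> R) x e :
  continuous F -> 0 < e -> exists2 d, 0 < d & forall y, enorm (y - x) < d ->
    `|F y - F x| <= e.
Proof.
move=> cF e0; have /cvgrPdist_le/(_ e e0)/nbhs_ballP[d /= d0 H] := cF x.
exists d => // y yx; rewrite distrC; apply: H; rewrite -ball_normE /= distrC.
exact: le_lt_trans (norm_le_enorm _) yx.
Qed.

Definition grad (R : realType) n (f : 'rV[R]_n -> R) (x : 'rV[R]_n) : 'rV[R]_n :=
  \row_i pd i f x.

(** [C2] speaks of partial derivatives only, so the chain rule along a line is recovered by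
    switching on the coordinates of [v] one at a time. Each new coordinate costs one mean value
    theorem, whose intermediate point is compared with [x] by continuity of that partial
    derivative. *)
Lemma is_derive_line (R : realType) n (f : 'rV[R]_n -> R) (a v : 'rV[R]_n) (t : R) :
  (forall i x, derivable f x (@evec R n i)) -> (forall i, continuous (pd i f)) ->
  is_derive t 1 (fun t => f (a + t *: v)) (dotp (grad f (a + t *: v)) v).
Proof.
move=> df cf.
pose w k : 'rV[R]_n := \sum_(i < n | (i < k)%N) v ord0 i *: @evec R n i.
pose D k x : R := \sum_(i < n | (i < k)%N) v ord0 i * pd i f x.
suff main k : (k <= n)%N -> forall x e, 0 < e -> exists2 delta, 0 < delta &
    forall s, `|s| < delta -> `|f (x + s *: w k) - f x - s * D k x| <= e * `|s|.
  have wn : w n = v.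
    rewrite /w [RHS]row_sum_delta; apply: eq_big => // i; exact: ltn_ord.
  have Dn x : D n x = dotp (grad f x) v.
    apply: eq_big => // i; first exact: ltn_ord.
    by rewrite mxE mulrC.
  apply/is_derive_epsP => e e0.
  have [d d0 H] := main n (leqnn n) (a + t *: v) e e0.
  exists d => // s sd; have := H s sd; rewrite wn Dn.
  by rewrite (_ : a + t *: v + s *: v = a + (t + s) *: v) // scalerDl addrA.
elim: k => [|k IH] kn x e e0.
  exists 1 => // s _; rewrite /w /D !big_pred0 // scaler0 addr0 subrr mulr0 subrr.
  by rewrite normr0 mulr_ge0 // ltW.
pose i := Ordinal kn; pose c := v ord0 i; pose E := @evec R n i.
have splitk (V : nmodType) (F : 'I_n -> V) :
    \sum_(j < n | (j < k.+1)%N) F j = F i + \sum_(j < n | (j < k)%N) F j.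
  rewrite (bigD1 i) //=; congr (_ + _); apply: eq_bigl => j.
  by rewrite ltnS [RHS]ltn_neqAle andbC.
have wS : w k.+1 = c *: E + w k by rewrite /w splitk.
have DS y : D k.+1 y = c * pd i f y + D k y by rewrite /D splitk.
have e20 : 0 < e / 2 by rewrite divr_gt0.
have [d1 d10 H1] := IH (ltnW kn) x (e / 2) e20.
have C0 : 0 < `|c| + 1 by rewrite ltr_wpDl.
have e30 : 0 < e / 2 / (`|c| + 1) by rewrite divr_gt0.
have [d2 d20 H2] := continuous_eps x (cf i) e30.
(* The intermediate point is within [|s| * L] of [x]; the [+ 1] here and in [C0] avoids division by
   zero. *)
pose L := enorm (w k) + `|c| * enorm E + 1.
have L0 : 0 < L by rewrite ltr_wpDl // addr_ge0 ?mulr_ge0 ?enorm_ge0.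
exists (Num.min d1 (d2 / L)); first by rewrite lt_min d10 divr_gt0.
move=> s; rewrite lt_min => /andP[sd1 sd2].
pose y := x + s *: w k.
have [sg sg_le Hsg] := @mean_value0 R (fun t => f (y + t *: E))
  (fun t => pd i f (y + t *: E)) (s * c) (fun t => @is_derive_coord _ _ f i y t (df i)).
have -> : x + s *: w k.+1 = y + (s * c) *: E.
  by rewrite wS scalerDr scalerA /y addrA addrAC.
rewrite DS.
have -> : f (y + (s * c) *: E) - f x - s * (c * pd i f x + D k x) =
   s * c * (pd i f (y + sg *: E) - pd i f x) + (f y - f x - s * D k x).
  move: Hsg; rewrite /= scale0r addr0 => Hsg.
  have -> : f (y + (s * c) *: E) = pd i f (y + sg *: E) * (s * c) + f y by rewrite -Hsg subrK.
  ring.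
apply: le_trans (ler_normD _ _) _.
have := H1 s sd1; rewrite -/y.
suff : `|s * c * (pd i f (y + sg *: E) - pd i f x)| <= e / 2 * `|s| by lra.
rewrite !normrM.
have : `|pd i f (y + sg *: E) - pd i f x| <= e / 2 / (`|c| + 1).
  apply: H2; have -> : y + sg *: E - x = s *: w k + sg *: E.
    by rewrite /y addrAC (addrC x) addrK.
  apply: le_lt_trans (enormD _ _) _; rewrite !enormZ.
  apply: (@le_lt_trans _ _ (`|s| * (enorm (w k) + `|c| * enorm E))).
    rewrite mulrDr lerD2l mulrA -normrM.
    by rewrite ler_wpM2r ?enorm_ge0.
  apply: (@le_lt_trans _ _ (`|s| * L)); last by rewrite -ltr_pdivlMr.
  by rewrite ler_wpM2l // /L lerDl.
move=> H; apply: le_trans (ler_wpM2l _ H) _; first by rewrite mulr_ge0.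
rewrite -mulrA mulrC -mulrA.
have : `|c| * (e / 2 / (`|c| + 1)) <= e / 2.
  by rewrite mulrA ler_pdivrMr // mulrC ler_wpM2l ?(ltW e20) // lerDl.
by move=> Hc; have := ler_wpM2l (normr_ge0 s) Hc; lra.
Qed.

Definition hessb (R : realType) n (f : 'rV[R]_n -> R) (x u v : 'rV[R]_n) : R :=
  \sum_(i < n) \sum_(j < n) pd j (pd i f) x * u ord0 i * v ord0 j.

Lemma is_derive_grad (R : realType) n (f : 'rV[R]_n -> R) (b v w : 'rV[R]_n) (t : R) :
  C2 f ->
  is_derive t 1 (fun t => dotp (grad f (b + t *: w)) v) (hessb f (b + t *: w) v w).
Proof.
move=> [_ _ _ ddf cddf].
have -> : (fun t => dotp (grad f (b + t *: w)) v) =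
    \sum_(i < n) (v ord0 i \*: (fun t => pd i f (b + t *: w))).
  apply/funext => s; rewrite fct_sumE /dotp; apply: eq_bigr => i _.
  by rewrite mxE mulrC.
have -> : hessb f (b + t *: w) v w =
    \sum_(i < n) v ord0 i *: dotp (grad (pd i f) (b + t *: w)) w.
  apply: eq_bigr => i _; rewrite /dotp /GRing.scale /= mulr_sumr.
  by apply: eq_bigr => j _; rewrite mxE; ring.
apply: is_derive_sum => i; apply: is_deriveZ.
by apply: is_derive_line.
Qed.

(** Both sides are derivatives at [s = 0] of [f (t *: x + s *: E)], which homogeneity rewrites as
    [t ^ q * f (x + (s / t) *: E)]. *)
Lemma pd_homogeneous (R : realType) n (q : R) (f : 'rV[R]_n -> R) i :
  (forall t x, 0 < t -> f (t *: x) = t `^ q * f x) ->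
  (forall x, derivable f x (@evec R n i)) ->
  forall t x, 0 < t -> pd i f (t *: x) = t `^ (q - 1) * pd i f x.
Proof.
move=> hf df t x t0; set E := @evec R n i.
have D1 := @is_derive_coord _ _ f i (t *: x) 0 df.
have D2 : is_derive (0 : R) 1 (fun s => f (t *: x + s *: E)) (t `^ q * (pd i f x / t)).
  have := @is_derive_coord _ _ f i x 0 df.
  rewrite scale0r addr0 => /is_derive_epsP D; apply/is_derive_epsP => e e0.
  have tq : 0 < t `^ q by rewrite powR_gt0.
  have e0' : 0 < e * t / t `^ q by rewrite divr_gt0 // mulr_gt0.
  have [d d0 H] := D _ e0'; exists (d * t); first by rewrite mulr_gt0.
  move=> s; rewrite -ltr_pdivrMr // => sd.
  have fE r : f (t *: x + r *: E) = t `^ q * f (x + (r / t) *: E).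
    rewrite -hf // scalerDr scalerA (mulrC r) mulrA divff ?mul1r //.
    by rewrite gt_eqF.
  have := H (s / t); rewrite normrM normfV (gtr0_norm t0) => /(_ sd).
  rewrite !fE !add0r scale0r addr0 mul0r scale0r addr0.
  move=> Hs; rewrite -(@ler_pM2l _ (t / t `^ q)^-1) ?invr_gt0 ?divr_gt0 //.
  have -> : t `^ q * f (x + (s / t) *: E) - t `^ q * f x - s * (t `^ q * (pd i f x / t))
     = t `^ q * (f (x + (s / t) *: E) - f x - s / t * pd i f x) by ring.
  rewrite normrM (gtr0_norm tq); have := ler_wpM2l (ltW tq) Hs.
  rewrite -(@ler_pM2l _ (t / t `^ q)^-1) ?invr_gt0 ?divr_gt0 //.
  move/le_trans; apply; rewrite ler_pM2l ?invr_gt0 ?divr_gt0 //.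
  rewrite le_eqVlt; apply/orP; left; apply/eqP; field.
  by rewrite !gt_eqF.
have := derive_val (is_derive := D1); rewrite (derive_val (is_derive := D2)) scale0r addr0 => <-.
by rewrite powRB ?powRr1 ?(ltW t0) ?(gt_eqF t0) ?implybT //; ring.
Qed.

(** * Uniform bounds by compactness, and the Hessian as a bilinear form *)

Lemma compact_enorm_ball (R : realType) n (M : R) :
  compact [set x : 'rV[R]_n | enorm x <= M].
Proof.
have [M0|M0] := ltP M 0.
  rewrite (_ : mkset _ = set0); first exact: compact0.
  apply/seteqP; split => // x /= xM.
  by have := enorm_ge0 x; rewrite leNgt (le_lt_trans xM).
have -> : [set x : 'rV[R]_n | enorm x <= M] = [set x | dotp (x - 0) (x - 0) <= M ^+ 2].
  apply/seteqP; split => x /=; rewrite subr0 -enorm_sqr ler_pXn2r ?nnegrE ?enorm_ge0 //.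
exact: compact_dotp_ball.
Qed.

Lemma bounded_on_ball (R : realType) n (F : 'rV[R]_n -> R) (M : R) :
  continuous F -> exists2 C, 0 <= C & forall x, enorm x <= M -> `|F x| <= C.
Proof.
move=> cF.
have cK : compact (F @` [set x | enorm x <= M]).
  apply: continuous_compact; last exact: compact_enorm_ball.
  exact: continuous_subspaceT.
have [C [_ HC]] := compact_bounded cK.
exists (`|C| + 1); first by rewrite addr_ge0.
move=> x xM; apply: (HC (`|C| + 1)); last by exists x.
by rewrite (le_lt_trans (ler_norm C)) // ltrDl.
Qed.

Lemma coord_le_enorm (R : realType) n (u : 'rV[R]_n) i : `|u ord0 i| <= enorm u.
Proof. exact: le_trans (coord_le_norm u i) (norm_le_enorm u). Qed.

Lemma hessb_bounded (R : realType) n (f : 'rV[R]_n -> R) (M : R) : C2 f ->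
  exists2 C, 0 < C & forall x u v, enorm x <= M ->
    `|hessb f x u v| <= C * enorm u * enorm v.
Proof.
move=> [_ _ _ _ cddf].
have B i j := @bounded_on_ball _ _ _ M (cddf i j).
pose C i j := s2val (cid2 (B i j)).
have C0 i j : 0 <= C i j by rewrite /C; case: cid2.
have CB i j x : enorm x <= M -> `|pd j (pd i f) x| <= C i j.
  by rewrite /C; case: cid2 => /= c c0; apply.
exists (\sum_(i < n) \sum_(j < n) C i j + 1).
  by rewrite ltr_wpDl // sumr_ge0 // => i _; rewrite sumr_ge0.
move=> x u v xM; apply: (@le_trans _ _ ((\sum_(i < n) \sum_(j < n) C i j) * enorm u * enorm v)).
  apply: le_trans (ler_norm_sum _ _ _) _; rewrite -mulrA mulr_suml.
  apply: ler_sum => i _; apply: le_trans (ler_norm_sum _ _ _) _; rewrite mulr_suml.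
  apply: ler_sum => j _; rewrite !normrM mulrA.
  by rewrite !ler_pM ?mulr_ge0 // ?CB // coord_le_enorm.
by rewrite ler_wpM2r ?enorm_ge0 // ler_wpM2r ?enorm_ge0 // lerDl.
Qed.

Lemma hessbDr (R : realType) n (f : 'rV[R]_n -> R) x u v w :
  hessb f x u (v + w) = hessb f x u v + hessb f x u w.
Proof.
rewrite /hessb -big_split; apply: eq_bigr => i _; rewrite -big_split.
by apply: eq_bigr => j _; rewrite mxE mulrDr.
Qed.

Lemma hessbZr (R : realType) n (f : 'rV[R]_n -> R) x u v t :
  hessb f x u (t *: v) = t * hessb f x u v.
Proof.
rewrite /hessb mulr_sumr; apply: eq_bigr => i _; rewrite mulr_sumr.
by apply: eq_bigr => j _; rewrite mxE; ring.
Qed.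

Lemma continuous_hessb (R : realType) n (f : 'rV[R]_n -> R) u v : C2 f ->
  continuous (fun x => hessb f x u v).
Proof.
move=> [_ _ _ _ cddf]; apply: continuous_sumr => i; apply: continuous_sumr => j.
apply: continuous_mulr; last exact: cst_continuous.
apply: continuous_mulr; last exact: cst_continuous.
exact: cddf.
Qed.

(* At the origin the Hessian is only controlled by continuity. *)
Lemma hessb_le0 (R : realType) n (f : 'rV[R]_n -> R) u v : C2 f ->
  (forall x, x != 0 -> hessb f x u v <= 0) -> forall x, hessb f x u v <= 0.
Proof.
move=> Cf H x; have [->|] := eqVneq x 0; last exact: H.
have [->|u0] := eqVneq u 0.
  by rewrite /hessb big1 // => i _; rewrite big1 // => j _; rewrite mxE mulr0 mul0r.
rewrite leNgt; apply/negP => pos.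
have e0 : 0 < hessb f 0 u v / 2 by rewrite divr_gt0.
have [d d0 Hd] := continuous_eps 0 (@continuous_hessb _ _ _ u v Cf) e0.
have nu := enorm_gt0 u0.
pose y := (d / 2 / enorm u) *: u.
have c0 : 0 < d / 2 / enorm u by rewrite !divr_gt0.
have : `|hessb f y u v - hessb f 0 u v| <= hessb f 0 u v / 2.
  apply: Hd; rewrite subr0 enormZ gtr0_norm // divfK ?gt_eqF //.
  by rewrite ltr_pdivrMr // mulr_natr mulr2n ltrDl.
have := H y; rewrite scaler_eq0 gt_eqF //= => /(_ u0).
rewrite ler_norml => Hy /andP[Hy1 _].
move: pos Hy Hy1; clear; move: (hessb f y u v) (hessb f 0 u v) => a b; lra.
Qed.

(** * Elliptic homogeneous costs *)

Definition elliptic_cost (R : realType) n (p lam : R) (h : 'rV[R]_n -> R) : Prop :=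
  [/\ 2 <= p, C2 h, (forall t x, 0 < t -> h (t *: x) = t `^ p * h x), 0 < lam &
    forall x v, enorm x = 1 -> lam * enorm v ^+ 2 <= hess_form h x v].

Lemma hessb_homogeneous (R : realType) n (p lam : R) (h : 'rV[R]_n -> R) t x u v :
  elliptic_cost p lam h -> 0 < t ->
  hessb h (t *: x) u v = t `^ (p - 2) * hessb h x u v.
Proof.
move=> [_ [_ dh _ ddh _] hh _ _] t0.
rewrite /hessb mulr_sumr; apply: eq_bigr => i _; rewrite mulr_sumr.
apply: eq_bigr => j _; rewrite (@pd_homogeneous _ _ (p - 1) (pd i h) j) //.
  by rewrite -!mulrA; congr (_ `^ _ * _); ring.
by move=> s y s0; apply: pd_homogeneous.
Qed.

Lemma hessb_sphere (R : realType) n (p lam : R) (h : 'rV[R]_n -> R) x u v :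
  elliptic_cost p lam h -> x != 0 ->
  hessb h x u v = enorm x `^ (p - 2) * hessb h ((enorm x)^-1 *: x) u v /\
  enorm ((enorm x)^-1 *: x) = 1.
Proof.
move=> hh x0; have e0 := enorm_gt0 x0; split.
  rewrite -(hessb_homogeneous _ _ _ hh e0) scalerA divff ?scale1r //.
  by rewrite gt_eqF.
by rewrite enormZ gtr0_norm ?invr_gt0 // mulVf // gt_eqF.
Qed.

Lemma hessb_lower (R : realType) n (p lam : R) (h : 'rV[R]_n -> R) x v :
  elliptic_cost p lam h -> x != 0 ->
  lam * enorm x `^ (p - 2) * enorm v ^+ 2 <= hessb h x v v.
Proof.
move=> hh x0; have [-> x1] := hessb_sphere v v hh x0.
case: hh => _ _ _ _ H; rewrite mulrAC mulrC ler_wpM2l ?powR_ge0 //.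
exact: H.
Qed.

Lemma hessb_upper (R : realType) n (p lam : R) (h : 'rV[R]_n -> R) :
  elliptic_cost p lam h -> exists2 C, 0 < C & forall x u v, x != 0 ->
  `|hessb h x u v| <= C * enorm x `^ (p - 2) * enorm u * enorm v.
Proof.
move=> hh; have [C C0 HC] : exists2 C, 0 < C & forall x u v, enorm x <= 1 ->
    `|hessb h x u v| <= C * enorm u * enorm v.
  by case: hh => _ Ch _ _ _; exact: hessb_bounded.
exists C => // x u v x0; have [-> x1] := hessb_sphere u v hh x0.
rewrite normrM ger0_norm ?powR_ge0 // (mulrC C) -!mulrA ler_wpM2l ?powR_ge0 //.
by rewrite mulrA; apply: HC; rewrite x1.
Qed.

Lemma hessb_ge0 (R : realType) n (p lam : R) (h : 'rV[R]_n -> R) x v :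
  elliptic_cost p lam h -> 0 <= hessb h x v v.
Proof.
(* Written for the pair [v], [-1 *: v], so that the sign result which includes the origin
   applies. *)
move=> hh; rewrite -oppr_le0 -mulN1r -hessbZr; apply: hessb_le0.
  by case: hh.
move=> y y0; rewrite hessbZr mulN1r oppr_le0.
apply: le_trans (hessb_lower v hh y0).
by case: hh => _ _ _ l0 _; rewrite !mulr_ge0 ?powR_ge0 ?enorm_ge0 ?ltW // exprn_ge0 ?enorm_ge0.
Qed.

(** The segment may run close to the origin, where the Hessian can degenerate. Mean-value points in
    its first and last quarters are at least [|w| / 2] apart, so one of them has norm at least
    [|w| / 4]. That quarter alone gives the bound, the rest contributing nonnegatively; its length
    is the leading [4^-1]. *)
Lemma grad_strongly_monotone (R : realType) n (p lam : R) (h : 'rV[R]_n -> R) b w :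
  elliptic_cost p lam h -> w != 0 ->
  4^-1 * (lam * (enorm w / 4) `^ (p - 2) * enorm w ^+ 2) <=
    dotp (grad h (b + w) - grad h b) w.
Proof.
move=> hh w0; have W0 := enorm_gt0 w0.
have Ch : C2 h by case: hh.
have l0 : 0 < lam by case: hh.
have p2 : 0 <= p - 2 by case: hh; lra.
pose psi (t : R) := dotp (grad h (b + t *: w)) w.
pose H (t : R) := hessb h (b + t *: w) w w.
have dpsi (t : R) : is_derive t 1 psi (H t) by exact: is_derive_grad.
have H0 t : 0 <= H t by exact: hessb_ge0 _ _ hh.
have Hlarge t : enorm w / 4 <= enorm (b + t *: w) ->
    lam * (enorm w / 4) `^ (p - 2) * enorm w ^+ 2 <= H t.
  move=> wt; have t0 : b + t *: w != 0.
    apply/eqP => E; move: wt; rewrite E enorm0; apply/negP; rewrite -ltNge.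
    by rewrite divr_gt0.
  apply: le_trans (hessb_lower w hh t0).
  rewrite ler_wpM2r ?exprn_ge0 ?enorm_ge0 // ler_wpM2l ?(ltW l0) //.
  by apply: ge0_ler_powR; rewrite ?nnegrE ?enorm_ge0 ?divr_ge0 ?enorm_ge0.
have [q1 q2] : (4^-1 < 3/4 :> R) /\ (3/4 < 1 :> R) by clear; split; lra.
have [c1 /andP[c10 c11] E1] : exists2 c, 0 < c < 4^-1 & psi 4^-1 - psi 0 = H c * (4^-1 - 0).
  by apply: mean_value.
have [c2 _ E2] : exists2 c, 4^-1 < c < 3/4 & psi (3/4) - psi 4^-1 = H c * (3/4 - 4^-1).
  by apply: mean_value.
have [c3 /andP[c30 c31] E3] : exists2 c, 3/4 < c < 1 & psi 1 - psi (3/4) = H c * (1 - 3/4).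
  by apply: mean_value.
have -> : dotp (grad h (b + w) - grad h b) w = psi 1 - psi 0.
  by rewrite /psi scale1r scale0r addr0 dotpDl dotpNl.
have big13 : enorm w / 4 <= enorm (b + c1 *: w) \/ enorm w / 4 <= enorm (b + c3 *: w).
  have [|s1] := leP (enorm w / 4) (enorm (b + c1 *: w)); first by left.
  have [|s3] := leP (enorm w / 4) (enorm (b + c3 *: w)); first by right.
  exfalso; have := enormB (b + c3 *: w) (b + c1 *: w).
  have -> : b + c3 *: w - (b + c1 *: w) = (c3 - c1) *: w.
    by apply/rowP => i; rewrite !mxE; ring.
  have c13 : 2^-1 <= c3 - c1 by move: c30 c11; clear; lra.
  rewrite enormZ ger0_norm; last by move: c13; clear; lra.
  have : 2^-1 * enorm w <= (c3 - c1) * enorm w by rewrite ler_pM2r.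
  move: s1 s3; clear; move: (enorm w) (enorm (b + c1 *: w)) (enorm (b + c3 *: w)) => x y z.
  move: ((c3 - c1) * x) => t; lra.
have h1 := H0 c1; have h2 := H0 c2; have h3 := H0 c3.
set X := lam * _ * _.
have : X <= H c1 \/ X <= H c3 by case: big13 => /Hlarge; [left|right].
move: E1 E2 E3 h1 h2 h3; rewrite -/X.
move: (psi 1) (psi (3 / 4)) (psi 4^-1) (psi 0) (H c1) (H c2) (H c3) X => a a1 a2 a3 x1 x2 x3 X.
clear => E1 E2 E3 h1 h2 h3 [] HX; lra.
Qed.

Lemma grad_holder (R : realType) n (p lam : R) (h : 'rV[R]_n -> R) :
  elliptic_cost p lam h -> exists2 c, 0 < c & forall a b,
  c * enorm (b - a) `^ (p - 1) <= enorm (grad h b - grad h a).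
Proof.
move=> hh; have l0 : 0 < lam by case: hh.
have p2 : 2 <= p by case: hh.
exists (4^-1 * (lam * 4^-1 `^ (p - 2))).
  by rewrite !mulr_gt0 ?powR_gt0 ?invr_gt0.
move=> a b; have [->|ab] := eqVneq b a.
  by rewrite !subrr enorm0 powR0 ?mulr0 ?enorm_ge0 // subr_eq0 gt_eqF //; lra.
have w0 : b - a != 0 by rewrite subr_eq0.
have W0 := enorm_gt0 w0.
have := grad_strongly_monotone a hh w0; rewrite (addrC a) subrK.
set w := b - a in w0 W0 *; set g := grad h b - grad h a => H.
have {H} := le_trans H (dotp_le _ _).
rewrite powRM ?invr_ge0 ?enorm_ge0 //.
have -> : enorm w `^ (p - 1) = enorm w `^ (p - 2) * enorm w.
  by rewrite -{3}(powRr1 (ltW W0)) -powRD ?(gt_eqF W0) ?implybT //; congr (_ `^ _); ring.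
move=> H; rewrite -(ler_pM2r W0); apply: le_trans H.
by rewrite le_eqVlt; apply/orP; left; apply/eqP; ring.
Qed.

(** Testing the vector increment against itself reduces to the scalar mean value theorem.
    Intermediate points have norm at most [M + 2 * M], hence the Hessian bound on radius [3 * M]. *)
Lemma grad_lipschitz (R : realType) n (h : 'rV[R]_n -> R) (M : R) : C2 h ->
  exists2 L, 0 < L & forall a b, enorm a <= M -> enorm b <= M ->
  enorm (grad h b - grad h a) <= L * enorm (b - a).
Proof.
move=> Ch; have [L L0 HL] := hessb_bounded (3 * M) Ch.
exists L => // a b aM bM; set v := grad h b - grad h a; set w := b - a.
pose psi (t : R) := dotp (grad h (a + t *: w)) v.
have [c /andP[c0 c1]] : exists2 c, 0 < c < 1 &
    psi 1 - psi 0 = hessb h (a + c *: w) v w * (1 - 0).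
  by apply: mean_value => // t; exact: is_derive_grad.
have -> : psi 1 - psi 0 = enorm v ^+ 2.
  rewrite enorm_sqr /psi scale1r scale0r addr0 (addrC a) subrK.
  by rewrite -dotpNl -dotpDl.
rewrite subr0 mulr1 => E.
have [->|v0] := eqVneq v 0; first by rewrite enorm0 mulr_ge0 ?enorm_ge0 // ltW.
rewrite -(ler_pM2l (enorm_gt0 v0)) -expr2 E.
have ac : enorm (a + c *: w) <= 3 * M.
  apply: le_trans (enormD _ _) _; rewrite enormZ gtr0_norm //.
  have := enormB b a; rewrite -/w => ww.
  have : c * enorm w <= enorm w by rewrite ler_piMl ?enorm_ge0 // ltW.
  move: aM bM ww; clear; move: (enorm a) (enorm b) (enorm w) => x y z.
  move: (c * z) => t; lra.
have := HL _ v w ac; have := ler_norm (hessb h (a + c *: w) v w).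
by move=> /le_trans/[apply]; rewrite mulrA (mulrC L).
Qed.

(* Ellipticity makes the second difference negative as soon as [w] lies in a
   fixed convex cone around [- v]. *)
Lemma second_difference_lt0 (R : realType) n (p lam : R) (h : 'rV[R]_n -> R) :
  elliptic_cost p lam h -> exists2 theta, 0 < theta < 1 & forall a v w s,
  v != 0 -> 0 < s -> enorm (w + s *: v) <= theta * s * enorm v ->
  h (a + w + v) - h (a + v) - (h (a + w) - h a) < 0.
Proof.
move=> hh; have Ch : C2 h by case: hh.
have l0 : 0 < lam by case: hh.
have [C C0 HC] := hessb_upper hh.
(* With this opening the deviation of [w] from [- s *: v] spends at most half of the ellipticity. *)
pose theta := Num.min 2^-1 (lam / (2 * C)).
have th0 : 0 < theta.
  by rewrite lt_min; apply/andP; split; rewrite ?invr_gt0 // divr_gt0 ?mulr_gt0.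
have th2 : theta <= 2^-1 by rewrite ge_min lexx.
have thC : C * theta <= lam / 2.
  apply: (@le_trans _ _ (C * (lam / (2 * C)))).
    by rewrite ler_pM2l // ge_min lexx orbT.
  by rewrite le_eqVlt; apply/orP; left; apply/eqP; field; rewrite gt_eqF.
have th1 : theta < 1 by apply: le_lt_trans th2 _; rewrite invf_lt1 // ltr1n.
exists theta; first by rewrite th0.
move=> a v w s v0 s0 wv; have V0 := enorm_gt0 v0.
have w0 : w != 0.
  apply/eqP => w0; move: wv; rewrite w0 add0r enormZ gtr0_norm //.
  apply/negP; rewrite -ltNge ltr_pM2r // gtr_pMl //.
have neg x : x != 0 -> hessb h x v w < 0.
  move=> x0; have X0 : 0 < enorm x `^ (p - 2) by rewrite powR_gt0 // enorm_gt0.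
  have -> : hessb h x v w = hessb h x v (w + s *: v) - s * hessb h x v v.
    by rewrite hessbDr hessbZr addrK.
  have lo := hessb_lower v hh x0.
  have up := le_trans (ler_norm _) (HC x v (w + s *: v) x0).
  have up2 : C * enorm x `^ (p - 2) * enorm v * enorm (w + s *: v) <=
      s * (lam / 2 * enorm x `^ (p - 2) * enorm v ^+ 2).
    apply: (@le_trans _ _ (C * enorm x `^ (p - 2) * enorm v * (theta * s * enorm v))).
      by apply: ler_wpM2l => //; rewrite !mulr_ge0 ?(ltW C0) ?(ltW X0) ?(ltW V0).
    have : C * theta * (enorm x `^ (p - 2) * s * enorm v ^+ 2) <=
       lam / 2 * (enorm x `^ (p - 2) * s * enorm v ^+ 2).
      by apply: ler_wpM2r => //; rewrite !mulr_ge0 ?exprn_ge0 ?(ltW s0) ?(ltW X0) ?(ltW V0).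
    clear; move: (enorm x `^ _) (enorm v) => y z; lra.
  have pos : 0 < s * (lam / 2 * enorm x `^ (p - 2) * enorm v ^+ 2).
    by rewrite !mulr_gt0 // exprn_gt0.
  have := ler_wpM2l (ltW s0) lo.
  move: up up2 pos; clear.
  move: (enorm x `^ _) (enorm v) (hessb h x v v) (hessb h x v _) (enorm (w + _)).
  move=> y z a1 a2 a3; lra.
have neg0 x : hessb h x v w <= 0.
  by apply: hessb_le0 => // y /neg/ltW.
have gradv b : dotp (grad h (b + w)) v < dotp (grad h b) v.
  pose psi (t : R) := dotp (grad h (b + t *: w)) v.
  have dpsi (t : R) : is_derive t 1 psi (hessb h (b + t *: w) v w) by exact: is_derive_grad.
  (* Two mean-value points are taken because [neg] fails at the origin: as [w] is nonzero, at most
     one of them is the origin, so the total decrease is strict. *)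
  have [c1 /andP[c10 c11]] : exists2 c, 0 < c < 2^-1 &
      psi 2^-1 - psi 0 = hessb h (b + c *: w) v w * (2^-1 - 0).
    by apply: mean_value; rewrite ?invr_gt0.
  have [c2 /andP[c20 c21]] : exists2 c, 2^-1 < c < 1 &
      psi 1 - psi 2^-1 = hessb h (b + c *: w) v w * (1 - 2^-1).
    by apply: mean_value => //; rewrite invf_lt1 // ltr1n.
  have -> : dotp (grad h (b + w)) v = psi 1 by rewrite /psi scale1r.
  have -> : dotp (grad h b) v = psi 0 by rewrite /psi scale0r addr0.
  have n1 := neg0 (b + c1 *: w); have n2 := neg0 (b + c2 *: w).
  have : hessb h (b + c1 *: w) v w < 0 \/ hessb h (b + c2 *: w) v w < 0.
    have [z1|/neg] := eqVneq (b + c1 *: w) 0; last by left.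
    have [z2|/neg] := eqVneq (b + c2 *: w) 0; last by right.
    have : (c2 - c1) *: w = 0.
      transitivity (b + c2 *: w - (b + c1 *: w)); last by rewrite z1 z2 subrr.
      by apply/rowP => i; rewrite !mxE; ring.
    by move/eqP; rewrite scaler_eq0 (negbTE w0) orbF subr_eq0 gt_eqF // (lt_trans c11).
  move: n1 n2; clear.
  move: (psi 1) (psi 2^-1) (psi 0) (hessb h (b + c1 *: w) v w) (hessb h (b + c2 *: w) v w).
  move=> a1 a2 a3 x y nx ny []; lra.
pose phi (s : R) := h (a + w + s *: v) - h (a + s *: v).
have [c _] : exists2 c, 0 < c < 1 & phi 1 - phi 0 =
   (dotp (grad h (a + w + c *: v)) v - dotp (grad h (a + c *: v)) v) * (1 - 0).
  apply: mean_value => // t.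
  have dh b : is_derive t 1 (fun t => h (b + t *: v)) (dotp (grad h (b + t *: v)) v).
    by case: Ch => _ ? ? _ _; exact: is_derive_line.
  exact: is_deriveB (dh (a + w)) (dh a).
rewrite /phi !scale1r !scale0r !addr0 subr0 mulr1 => ->.
by rewrite subr_lt0 (addrAC a); exact: gradv.
Qed.

(** * h-monotone maps *)

Lemma ae_dense (R : realType) n (P : 'rV[R]_n -> Prop) (c : 'rV[R]_n) r :
  ae P -> 0 < r -> exists2 x, enorm (x - c) < r & P x.
Proof.
move=> /vol_lnull[B [mB PB B0]] r0.
have s0 : 0 < r / n.+1%:R by rewrite divr_gt0.
have [sub|] := pselect (ball c (r / n.+1%:R) `<=` B).
  have := le_vol (borel_ball c s0) mB sub.
  by rewrite B0 vol_ball // lee_fin leNgt exprn_gt0 // mulr_gt0.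
move=> /existsNP[x /not_implyP[cx Bx]]; exists x.
  move: cx; rewrite -ball_normE /= distrC => cx.
  apply: le_lt_trans (enorm_le_norm _) _.
  apply: (@le_lt_trans _ _ (n.+1%:R * `|x - c|)); first by rewrite ler_wpM2r // ler_nat.
  by rewrite mulrC -ltr_pdivlMr.
by apply: contrapT => nP; apply: Bx; exact: PB.
Qed.

(** With base point [y - xi] and increments [x - y] and [xi - zeta], the second difference of [h] is
    the right side minus the left side of h-monotonicity. It is nonnegative, so [xi - zeta] avoids
    the cone on which ellipticity makes it negative. *)
Lemma h_monotone_cone (R : realType) n (p lam : R) (h : 'rV[R]_n -> R)
    (T : 'rV[R]_n -> set 'rV[R]_n) :
  elliptic_cost p lam h -> h_monotone h T ->
  exists2 theta, 0 < theta < 1 & forall x y xi zeta s,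
    T x xi -> T y zeta -> x != y -> 0 < s ->
    theta * s * enorm (x - y) < enorm (xi - zeta + s *: (x - y)).
Proof.
move=> hh hT; have [theta th H] := second_difference_lt0 hh.
exists theta => // x y xi zeta s Tx Ty xy s0; rewrite ltNge; apply/negP => Hs.
have v0 : x - y != 0 by rewrite subr_eq0.
have := H (y - xi) (x - y) (xi - zeta) s v0 s0 Hs.
have -> : y - xi + (xi - zeta) = y - zeta by rewrite subrKA.
have -> : y - zeta + (x - y) = x - zeta by rewrite addrC subrKA.
have -> : y - xi + (x - y) = x - xi by rewrite addrC subrKA.
by have := hT _ _ _ _ Tx Ty; move: (h _) (h _) (h _) (h _) => ? ? ? ?; lra.
Qed.

(** Rounding each coordinate down on a grid of mesh [1 / m] in [[-1, 1]] suffices, with [m >= n / d]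
    to pass from the sup norm to the Euclidean one. The net points need not lie on the sphere. *)
Lemma sphere_net (R : realType) n (d : R) : 0 < d ->
  exists (I : finType) (g : I -> 'rV[R]_n),
    forall e, enorm e = 1 -> exists i, enorm (g i - e) <= d.
Proof.
move=> d0; pose m := (Num.truncn (n%:R / d)).+1.
have m0 : 0 < m%:R :> R by rewrite ltr0n.
exists {ffun 'I_n -> 'I_(2 * m).+1}.
exists (fun q : {ffun 'I_n -> 'I_(2 * m).+1} => \row_i ((q i)%:R / m%:R - 1)) => e e1.
have eb i : -1 <= e ord0 i <= 1.
  by rewrite -ler_norml -e1 coord_le_enorm.
pose q (i : 'I_n) := Num.truncn ((e ord0 i + 1) * m%:R).
have e0 i : 0 <= (e ord0 i + 1) * m%:R.
  by rewrite mulr_ge0 // -lerBlDr sub0r; case/andP: (eb i).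
have q1 i : (q i)%:R <= (e ord0 i + 1) * m%:R by case/andP: (truncn_itv (e0 i)).
have q2 i : (e ord0 i + 1) * m%:R < (q i)%:R + 1.
  by rewrite natr1; exact: truncnS_gt.
have qm i : (q i < (2 * m).+1)%N.
  rewrite ltnS -(ler_nat R) natrM; apply: le_trans (q1 i) _.
  by rewrite ler_pM2r // -lerBrDr (_ : 2 - 1 = 1 :> R); [case/andP: (eb i)|ring].
exists [ffun i => Ordinal (qm i)].
apply: le_trans (enorm_le_norm _) _.
have : `|\row_i (([ffun i => Ordinal (qm i)] i)%:R / m%:R - 1) - e| <= m%:R^-1.
  apply: norm_le_coord => [|i]; first by rewrite invr_ge0.
  rewrite !mxE ffunE /=.
  have -> : (q i)%:R / m%:R - 1 - e ord0 i = ((q i)%:R - (e ord0 i + 1) * m%:R) / m%:R.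
    by field; rewrite gt_eqF.
  rewrite normrM normfV (gtr0_norm m0) ler_pdivrMr // mulVf ?gt_eqF //.
  rewrite ler_norml; have := q1 i; have := q2 i; clear.
  by move: ((e ord0 i + 1) * m%:R) (q i)%:R => a b; lra.
move=> /(ler_wpM2l (ler0n R n)) Hn; apply: le_trans Hn _.
by rewrite ler_pdivrMr // mulrC -ler_pdivrMr // ltW // truncnS_gt.
Qed.

(* A huge value [xi] of [T] near the origin would force, through the cone
   condition, a huge value at every far point seen in the direction of [xi];
   finitely many points of the domain cover all the directions. *)
Lemma h_monotone_locally_bounded (R : realType) n (p lam : R) (h : 'rV[R]_n -> R)
    (T : 'rV[R]_n -> set 'rV[R]_n) (k : R) :
  elliptic_cost p lam h -> h_monotone h T -> ae (fun x => T x !=set0) -> 0 < k ->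
  exists2 M, 0 < M & forall x xi, enorm x <= k -> T x xi -> enorm xi <= M.
Proof.
move=> hh hT aeT k0; have [theta /andP[th0 th1] cone] := h_monotone_cone hh hT.
(* The net error and the error in choosing points of the domain are each [rho * theta / 16]. Below,
   [rho] makes [k = rho * theta / 8], and the claimed bound makes [Z <= X * theta / 8]. *)
pose d := theta / 16; have d0 : 0 < d by rewrite divr_gt0.
have [I [g net]] := @sphere_net R n d d0.
pose rho := 8 * k / theta; have rho0 : 0 < rho by rewrite divr_gt0 // mulr_gt0.
have rhok : rho * theta = 8 * k by rewrite divfK // gt_eqF.
have rd0 : 0 < rho * d by rewrite mulr_gt0.
have /(_ _)/cid-/all_sig[y Hy] (i : I) :
    exists y : 'rV[R]_n * 'rV[R]_n, enorm (y.1 - rho *: g i) < rho * d /\ T y.1 y.2.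
  by have [y yd [z Tyz]] := ae_dense (rho *: g i) aeT rd0; exists (y, z).
pose Z := \sum_i enorm (y i).2.
have Z0 : 0 <= Z by apply: sumr_ge0 => i _; exact: enorm_ge0.
exists (8 * Z / theta + 1); first by rewrite ltr_wpDl // divr_ge0 ?mulr_ge0 // ltW.
move=> x xi xk Tx; rewrite leNgt; apply/negP => big.
set X := enorm xi in big.
have X0 : 0 < X.
  by apply: lt_trans big; rewrite ltr_wpDl // divr_ge0 ?mulr_ge0 // ltW.
have ZX : 8 * Z <= X * theta.
  by rewrite -ler_pdivrMr // ltW // (le_lt_trans _ big) // lerDl.
have [|i ie] := net (X^-1 *: xi).
  by rewrite enormZ gtr0_norm ?invr_gt0 // mulVf // gt_eqF.
have [yi Ty] := Hy i; move: yi Ty; set y1 := (y i).1; set z1 := (y i).2 => yi Ty.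
have zZ : enorm z1 <= Z.
  by rewrite /Z (bigD1 i) //= lerDl sumr_ge0 // => j _; exact: enorm_ge0.
pose e := X^-1 *: xi.
have ye : enorm (y1 - rho *: e) <= rho * (theta / 8).
  have -> : y1 - rho *: e = (y1 - rho *: g i) + rho *: (g i - e).
    by rewrite scalerBr subrKA.
  apply: le_trans (enormD _ _) _; rewrite enormZ (gtr0_norm rho0).
  have := ler_wpM2l (ltW rho0) ie; rewrite -/e.
  move: yi; rewrite /d; move: (enorm _) (rho * enorm _) => a b; clear; lra.
have e1 : enorm e = 1 by rewrite enormZ gtr0_norm ?invr_gt0 // mulVf // gt_eqF.
have ylarge : rho * (1 - theta / 8) <= enorm y1.
  have := enormB y1 (y1 - rho *: e); rewrite opprB addrC subrK enormZ e1 (gtr0_norm rho0).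
  move: ye; move: (enorm y1) (enorm (y1 - _)) => a b; clear; lra.
have xy : rho * (1 - theta / 4) <= enorm (x - y1).
  have := enormB x (x - y1); rewrite opprB addrC subrK.
  move: ylarge xk rhok; move: (enorm y1) (enorm (x - y1)) (enorm x) => a b c; clear; nra.
have xy0 : x != y1.
  apply/eqP => xy0; move: xy; rewrite xy0 subrr enorm0; apply/negP; rewrite -ltNge.
  rewrite mulr_gt0 // subr_gt0 ltr_pdivrMr // mul1r (lt_trans th1) //.
  by rewrite ltr1n.
have s0 : 0 < X / rho by rewrite divr_gt0.
(* With [s = X / rho], [xi] cancels against [s *: (rho *: e)]. Three errors of size [X * theta / 8]
   remain, while the cone condition demands more than [theta * X * (1 - theta / 4)]. *)
have := cone x y1 xi z1 (X / rho) Tx Ty xy0 s0; apply/negP; rewrite -leNgt.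
have -> : xi - z1 + (X / rho) *: (x - y1) =
    - (X / rho) *: (y1 - rho *: e) + ((X / rho) *: x - z1).
  have {1}-> : xi = (X / rho) *: (rho *: e).
    by rewrite !scalerA divfK ?gt_eqF // divff ?scale1r // gt_eqF.
  by apply/rowP => j; rewrite !mxE; ring.
apply: le_trans (enormD _ _) _; rewrite enormZ normrN (gtr0_norm s0).
have := enormB ((X / rho) *: x) z1; rewrite enormZ (gtr0_norm s0) => xz.
have a1 := ler_wpM2l (ltW s0) ye.
have a2 := ler_wpM2l (ltW s0) xy.
have a3 := ler_wpM2l (ltW s0) xk.
have sr : X / rho * rho = X by rewrite divfK // gt_eqF.
have sk : X / rho * k = X * theta / 8.
  have -> : X / rho * k = X / rho * (rho * theta / 8) by rewrite rhok (mulrC 8) mulfK.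
  by rewrite 2!mulrA sr.
have a4 : theta * (X / rho * (rho * (1 - theta / 4))) <= theta * (X / rho * enorm (x - y1)).
  by rewrite ler_wpM2l // ltW.
move: a1 a3 a4 xz zZ ZX; rewrite !(mulrA (X / rho) rho) sr sk -(mulrA theta (X / rho)).
move: (enorm (_ - z1)) (X / rho * enorm (y1 - _)) (X / rho * enorm x).
move: (X / rho * enorm (x - y1)) (enorm z1) => a b c a' b'.
have : 0 <= X * theta * (1 - theta) by rewrite !mulr_ge0 ?subr_ge0 // ltW.
have := mulr_gt0 X0 th0.
clear; move: X Z => u v; lra.
Qed.

(** Expanding [h] from [x] to [y] once at [zeta] and once at [xi] turns h-monotonicity into an
    inequality between gradients at intermediate points. Replacing these by the endpoints [y - zeta]
    and [x - xi] costs [L * |v|^2] each, hence [K = 2 * L]; the extra identity turns monotone into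
    firm. *)
Lemma h_monotone_firm (R : realType) n (h : 'rV[R]_n -> R)
    (T : 'rV[R]_n -> set 'rV[R]_n) (k M : R) :
  C2 h -> h_monotone h T -> 0 < k -> 0 < M ->
  (forall x xi, enorm x <= k -> T x xi -> enorm xi <= M) ->
  exists K, let G := [set q : 'rV[R]_n * 'rV[R]_n | enorm q.2 <= k /\
     exists2 xi, T q.2 xi & q.1 = (1 + K) *: q.2 - grad h (q.2 - xi)] in
  firm G /\ exists B, forall q, G q -> enorm q.1 <= B.
Proof.
move=> Ch hT k0 M0 HM; have [L L0 HL] := grad_lipschitz (3 * k + M) Ch.
have dh b v (t : R) : is_derive t 1 (fun t => h (b + t *: v)) (dotp (grad h (b + t *: v)) v).
  by case: Ch => _ ? ? _ _; exact: is_derive_line.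
exists (2 * L) => G; split.
  move=> [z x] [z' y] [/= xk [xi /= Tx ->]] [/= yk [zeta /= Ty ->]].
  have xiM := HM _ _ xk Tx; have zeM := HM _ _ yk Ty.
  pose v := y - x.
  have [s /andP[s0 s1]] : exists2 s, 0 < s < 1 &
      h (x - zeta + 1 *: v) - h (x - zeta + 0 *: v) = dotp (grad h (x - zeta + s *: v)) v * (1 - 0).
    exact: mean_value.
  have [t /andP[t0 t1]] : exists2 t, 0 < t < 1 &
      h (x - xi + 1 *: v) - h (x - xi + 0 *: v) = dotp (grad h (x - xi + t *: v)) v * (1 - 0).
    exact: mean_value.
  rewrite !scale1r !scale0r !addr0 subr0 !mulr1.
  have -> : x - xi + v = y - xi by rewrite addrC subrKA.
  have -> : x - zeta + v = y - zeta by rewrite addrC subrKA.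
  have := hT _ _ _ _ Tx Ty => mono E1 E2.
  have vk : enorm v <= 2 * k.
    by apply: le_trans (enormB _ _) _; move: (enorm x) (enorm y) xk yk; clear => a b; lra.
  have nrm a u r : enorm a <= k -> enorm u <= M -> 0 < r -> r < 1 ->
      enorm (a - u + r *: v) <= 3 * k + M.
    move=> ak uM r0 r1; apply: le_trans (enormD _ _) _; rewrite enormZ gtr0_norm //.
    have := enormB a u; have : r * enorm v <= enorm v by rewrite ler_piMl ?enorm_ge0 // ltW.
    move: ak uM vk; clear.
    by move: (enorm (a - u)) (enorm a) (enorm u) (r * enorm v) (enorm v) => ? ? ? ? ?; lra.
  have nrm0 (a u : 'rV[R]_n) : enorm a <= k -> enorm u <= M -> enorm (a - u) <= 3 * k + M.
    move=> ak uM; apply: le_trans (enormB _ _) _; move: ak uM k0; clear.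
    by move: (enorm a) (enorm u) => ? ?; lra.
  have b1 : dotp (grad h (y - zeta) - grad h (x - zeta + s *: v)) v <= L * enorm v ^+ 2.
    apply: le_trans (dotp_le _ _) _; rewrite expr2 mulrA ler_wpM2r ?enorm_ge0 //.
    apply: le_trans (HL _ _ (nrm _ _ _ xk zeM s0 s1) (nrm0 _ _ yk zeM)) _.
    have -> : y - zeta - (x - zeta + s *: v) = (1 - s) *: v.
      by apply/rowP => j; rewrite !mxE; ring.
    rewrite ler_pM2l // enormZ ger0_norm ?subr_ge0 ?(ltW s1) //.
    by rewrite ler_piMl ?enorm_ge0 // gerBl ltW.
  have b2 : dotp (grad h (x - xi + t *: v) - grad h (x - xi)) v <= L * enorm v ^+ 2.
    apply: le_trans (dotp_le _ _) _; rewrite expr2 mulrA ler_wpM2r ?enorm_ge0 //.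
    apply: le_trans (HL _ _ (nrm0 _ _ xk xiM) (nrm _ _ _ xk xiM t0 t1)) _.
    rewrite addrAC subrr add0r ler_pM2l // enormZ gtr0_norm //.
    by rewrite ler_piMl ?enorm_ge0 // ltW.
  have -> : (1 + 2 * L) *: x - grad h (x - xi) - ((1 + 2 * L) *: y - grad h (y - zeta)) =
     - (1 + 2 * L) *: v + (grad h (y - zeta) - grad h (x - xi)).
    by apply/rowP => j; rewrite !mxE; ring.
  have -> : x - y = - v by rewrite opprB.
  clearbody v; rewrite dotpDr dotpZr !dotpNl !dotpNr opprK (dotpC v (_ - _)).
  move: b1 b2; rewrite !dotpDl !dotpNl enorm_sqr.
  move: E1 E2 mono; move: (h _) (h _) (h _) (h _) => ? ? ? ?.
  move: (dotp v v) (dotp (grad h _) v) (dotp (grad h _) v) => ? ? ?.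
  by move: (dotp (grad h _) v) (dotp (grad h _) v); clear => ? ?; lra.
exists ((1 + 2 * L) * k + (L * (k + M) + enorm (grad h 0))) => -[z x] [/= xk [xi /= Tx ->]].
apply: le_trans (enormB _ _) _; apply: lerD.
  by rewrite enormZ gtr0_norm ?ler_pM2l // ltr_wpDr // mulr_ge0 // ltW.
have xiM := HM _ _ xk Tx.
have xx : enorm (x - xi) <= k + M by apply: le_trans (enormB _ _) (lerD _ _).
have -> : grad h (x - xi) = (grad h (x - xi) - grad h 0) + grad h 0 by rewrite subrK.
apply: le_trans (enormD _ _) _; rewrite lerD2r.
have n0 : enorm (0 : 'rV[R]_n) <= 3 * k + M.
  by rewrite enorm0 addr_ge0 ?mulr_ge0 // ltW.
have n1 : enorm (x - xi) <= 3 * k + M by apply: le_trans xx _; move: k0; clear; lra.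
have := HL _ _ n0 n1; rewrite subr0 => /le_trans; apply.
by rewrite ler_pM2l.
Qed.

Theorem theorem5p5 (R : realType) (n : nat) (p : R) (h : 'rV[R]_n -> R)
    (lam Lam : R) (T : 'rV[R]_n -> set 'rV[R]_n) :
  2 <= p ->
  C2 h ->
  (forall x, 0 <= h x) ->
  (forall (t : R) x, 0 < t -> h (t *: x) = t `^ p * h x) ->
  0 < lam -> lam <= Lam ->
  (forall x v : 'rV[R]_n, enorm x = 1 ->
     lam * enorm v ^+ 2 <= hess_form h x v /\
     hess_form h x v <= Lam * enorm v ^+ 2) ->
  h_monotone h T ->
  Lloc_map (p - 1) T ->
  ae (fun x0 : 'rV[R]_n =>
    exists xi0 : 'rV[R]_n, T x0 = [set xi0] /\
    exists C R0 : R, 0 < R0 /\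
      forall r : R, 0 < r -> r < R0 ->
        ae (fun x : 'rV[R]_n => eball x0 r x ->
          forall xi, T x xi -> enorm (xi - xi0) <= C * r `^ (1 / (p - 1)))).
Proof.
move=> p2 Ch _ hh l0 _ hl hT [f [_ Tf _]].
have ell : elliptic_cost p lam h by split => // x v x1; case: (hl x v x1).
have [c c0 hol] := grad_holder ell.
have aeT : ae (fun x => T x !=set0).
  by apply: (lnullS _ Tf) => x /= TN E; apply: TN; rewrite E; exists (f x).
(* The bound on [T] and the Lipschitz constant of [grad h] depend on the ball, so one relation is
   built for each radius [k + 1], and the countably many null sets are united. *)
have rel (k : nat) : exists K, let G := [set q : 'rV[R]_n * 'rV[R]_n |
     enorm q.2 <= k.+1%:R /\
     exists2 xi, T q.2 xi & q.1 = (1 + K) *: q.2 - grad h (q.2 - xi)] in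
    firm G /\ exists B, forall q, G q -> enorm q.1 <= B.
  have k0 : 0 < k.+1%:R :> R by [].
  have [M M0 HM] := h_monotone_locally_bounded ell hT aeT k0.
  exact: h_monotone_firm HM.
have [K HK] := choice rel.
pose G k := [set q : 'rV[R]_n * 'rV[R]_n | enorm q.2 <= k.+1%:R /\
     exists2 xi, T q.2 xi & q.1 = (1 + K k) *: q.2 - grad h (q.2 - xi)].
pose bad k := [set x0 | exists2 z0, G k (z0, x0) & (forall z, G k (z, x0) -> z = z0) /\
    forall C, exists2 q, G k q & C * enorm (q.2 - x0) < enorm (q.1 - z0)].
have nbad : lnull (\bigcup_k bad k).
  apply: lnull_bigcup => k; have [fG [B GB]] := HK k.
  exact: (firm_inverse_lipschitz fG GB).
apply: (lnullS _ (lnullU Tf nbad)) => x0 /=.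
apply: contra_notP => /not_orP[/contrapT Tx0 good].
exists (f x0); split => //.
(* Index [k.+1] stands for radius [k + 2], which exceeds [|x0| + 1]: the unit ball around [x0] stays
   inside the truncation. *)
pose k := Num.truncn (enorm x0).
have x0k : enorm x0 + 1 < k.+2%:R.
  by rewrite -[k.+2%:R]natr1 ltrD2r; exact: truncnS_gt.
have Gx0 : G k.+1 ((1 + K k.+1) *: x0 - grad h (x0 - f x0), x0).
  split => /=; first by apply: ltW; apply: lt_trans x0k; rewrite ltrDl.
  by exists (f x0) => //; rewrite Tx0.
have [C HC] : exists C, forall q, G k.+1 q ->
    enorm (q.1 - ((1 + K k.+1) *: x0 - grad h (x0 - f x0))) <= C * enorm (q.2 - x0).
  apply: contrapT => NC; apply: good; exists k.+1 => //.
  exists ((1 + K k.+1) *: x0 - grad h (x0 - f x0)) => //; split.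
    by move=> z [_ [xi /= + ->]]; rewrite Tx0 => ->.
  move=> C; apply: contrapT => NC'; apply: NC; exists C => q Gq.
  by rewrite leNgt; apply/negP => lt; apply: NC'; exists q.
have p1 : 0 < p - 1 by rewrite subr_gt0 (lt_le_trans _ p2) // ltr1n.
pose q := 1 / (p - 1).
have q0 : 0 <= q by rewrite divr_ge0 // ltW.
have q1 : q <= 1 by rewrite ler_pdivrMr // mul1r lerBrDr.
(* Chosen so that the increment [w] of [x - T x] satisfies [|w| ^ (p - 1) <= D * r]: the numerator
   bounds the increment of [grad h] per unit of [r], and [c] comes from [grad_holder]. *)
pose D := (`|C| + `|1 + K k.+1|) / c.
have D0 : 0 <= D by rewrite divr_ge0 ?addr_ge0 // ltW.
(* [T x] is recovered as [x] minus [x - T x]. The summand [1] pays for the displacement of [x],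
   since [r <= r ^ q] when [r < 1] and [q <= 1]; hence [R0 = 1]. *)
exists (1 + D `^ q), 1; split => // r r0 r1.
(* At such an [x0] the estimate holds for every [x] in the ball and every value of [T x], so the
   inner exceptional set is empty. *)
apply: (lnullS _ (lnull0 R n)) => x /= []; rewrite /eball /= => xr xi Tx.
have xk : enorm x <= k.+2%:R.
  apply: ltW; apply: le_lt_trans x0k; rewrite -(subrK x0 x).
  apply: le_trans (enormD _ _) _; rewrite addrC lerD2l.
  exact: ltW (lt_trans xr r1).
have Gx : G k.+1 ((1 + K k.+1) *: x - grad h (x - xi), x) by split => //; exists xi.
have := HC _ Gx => /=.
set w := (x - xi) - (x0 - f x0).
set g := grad h (x - xi) - grad h (x0 - f x0).
have -> : (1 + K k.+1) *: x - grad h (x - xi) - ((1 + K k.+1) *: x0 - grad h (x0 - f x0))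
    = (1 + K k.+1) *: (x - x0) - g.
  by rewrite /g; apply/rowP => j; rewrite !mxE; ring.
move=> zx.
have gx : enorm g <= (`|C| + `|1 + K k.+1|) * r.
  have := enormB ((1 + K k.+1) *: (x - x0)) ((1 + K k.+1) *: (x - x0) - g).
  rewrite opprB addrC subrK enormZ => gle; apply: le_trans gle _.
  rewrite mulrDl addrC; apply: lerD; last by rewrite ler_wpM2l // ltW.
  apply: le_trans zx _; apply: (@le_trans _ _ (`|C| * enorm (x - x0))).
    by rewrite ler_wpM2r ?enorm_ge0 // ler_norm.
  by rewrite ler_wpM2l // ltW.
have wD : enorm w `^ (p - 1) <= D * r.
  by rewrite /D mulrAC ler_pdivlMr // [leLHS]mulrC; exact: le_trans (hol _ _) gx.
have wr : enorm w <= D `^ q * r `^ q.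
  rewrite -powRM // ?(ltW r0) //.
  have -> : enorm w = (enorm w `^ (p - 1)) `^ q.
    by rewrite -powRrM mulrCA divff ?mulr1 ?powRr1 ?enorm_ge0 // gt_eqF.
  apply: ge0_ler_powR => //; rewrite nnegrE; first exact: powR_ge0.
  by apply: mulr_ge0 => //; exact: ltW.
have rr : r <= r `^ q.
  by apply: ger1_powR => //; rewrite r0 ltW.
have -> : xi - f x0 = (x - x0) - w.
  by rewrite /w; apply/rowP => j; rewrite !mxE; ring.
apply: le_trans (enormB _ _) _; rewrite mulrDl mul1r; apply: lerD => //.
exact: le_trans (ltW xr) rr.
Qed.
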